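(* For sets of integer vectors $S_1,\dots,S_{16}\subseteq\mathbb{Z}^4$ as listed below, let $G_i=\mathrm{Cayley}(\mathbb{Z}^4,S_i)$. If $\Lambda\subseteq\mathbb{R}^4$ is a four-dimensional lattice, then its Voronoi graph $\mathrm{Cayley}(\Lambda,\mathrm{Vor}(\Lambda))$ is isomorphic (as a graph) to one of the $16$ graphs $G_1,\dots,G_{16}$. The graphs $G_1,\dots,G_{16}$ are pairwise non-isomorphic, and their chromatic numbers are as follows. (Here $S_i$ is the union of the listed pairs $v_j$, where each $v_j$ is the two-element set $\{u,-u\}$ specified in the context.) 1. $S_1=v_1\cup v_3\cup v_4\cup v_5\cup v_6\cup v_7\cup v_8\cup v_{10}\cup v_{11}\cup v_{12}\cup v_{13}\cup v_{14}\cup v_{15}\cup v_{16}\cup v_{17}$ (30 vectors), $\chi(G_1)=5$. 2. $S_2=v_1\cup v_2\cup v_3\cup v_5\cup v_6\cup v_7\cup v_8\cup v_9\cup v_{10}\cup v_{11}\cup v_{12}\cup v_{13}\cup v_{15}\cup v_{16}\cup v_{17}$ (30 vectors), $\chi(G_2)=7$. 3. $S_3=v_1\cup v_3\cup v_4\cup v_5\cup v_6\cup v_7\cup v_8\cup v_9\cup v_{10}\cup v_{11}\cup v_{12}\cup v_{13}\cup v_{15}\cup v_{16}\cup v_{17}$ (30 vectors), $\chi(G_3)=6$. 4. $S_4=v_1\cup v_3\cup v_4\cup v_5\cup v_6\cup v_7\cup v_8\cup v_{10}\cup v_{11}\cup v_{13}\cup v_{14}\cup v_{15}\cup v_{16}\cup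 v_{17}$ (28 vectors), $\chi(G_4)=5$. 5. $S_5=v_1\cup v_2\cup v_3\cup v_5\cup v_6\cup v_7\cup v_8\cup v_9\cup v_{10}\cup v_{11}\cup v_{12}\cup v_{13}\cup v_{16}\cup v_{17}$ (28 vectors), $\chi(G_5)=6$. 6. $S_6=v_1\cup v_3\cup v_4\cup v_5\cup v_7\cup v_8\cup v_{10}\cup v_{11}\cup v_{13}\cup v_{14}\cup v_{15}\cup v_{16}\cup v_{17}$ (26 vectors), $\chi(G_6)=5$. 7. $S_7=v_1\cup v_2\cup v_3\cup v_5\cup v_6\cup v_7\cup v_8\cup v_9\cup v_{10}\cup v_{11}\cup v_{12}\cup v_{13}\cup v_{17}$ (26 vectors), $\chi(G_7)=6$. 8. $S_8=v_1\cup v_3\cup v_4\cup v_5\cup v_7\cup v_8\cup v_{10}\cup v_{11}\cup v_{13}\cup v_{14}\cup v_{16}\cup v_{17}$ (24 vectors), $\chi(G_8)=5$. 9. $S_9=v_1\cup v_3\cup v_5\cup v_6\cup v_7\cup v_8\cup v_9\cup v_{10}\cup v_{11}\cup v_{12}\cup v_{13}\cup v_{17}$ (24 vectors), $\chi(G_9)=4$. 10. $S_{10}=v_1\cup v_3\cup v_4\cup v_5\cup v_6\cup v_8\cup v_{10}\cup v_{11}\cup v_{13}\cup v_{15}\cup v_{17}$ (22 vectors), $\chi(G_{10})=4$. 11. $S_{11}=v_1\cup v_3\cup v_4\cup v_5\cup v_7\cup v_8\cup v_{10}\cup v_{11}\cup v_{13}\cup v_{17}$ (20 vectors), $\chi(G_{11})=5$.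 12. $S_{12}=v_1\cup v_3\cup v_4\cup v_5\cup v_6\cup v_7\cup v_8\cup v_{10}$ (16 vectors), $\chi(G_{12})=4$. 13. $S_{13}=v_1\cup v_3\cup v_4\cup v_5\cup v_7\cup v_8\cup v_{10}$ (14 vectors), $\chi(G_{13})=4$. 14. $S_{14}=v_3\cup v_5\cup v_7\cup v_8\cup v_{10}\cup v_{17}$ (12 vectors), $\chi(G_{14})=3$. 15. $S_{15}=v_1\cup v_3\cup v_5\cup v_7\cup v_{10}$ (10 vectors), $\chi(G_{15})=3$. 16. $S_{16}=v_1\cup v_3\cup v_5\cup v_{10}$ (8 vectors), $\chi(G_{16})=2$.
   Context: An $n$-dimensional lattice $\Lambda\subseteq\mathbb{R}^n$ is the set of integer linear combinations of a basis of $\mathbb{R}^n$. Its Voronoi cell is $V(\Lambda)=\{x\in\mathbb{R}^n : \|x\|\le\|x-v\| \text{ for all } v\in\Lambda\}$ (Euclidean norm). A strict Voronoi vector of $\Lambda$ is a difference $v-w$ of distinct $v,w\in\Lambda$ such that $(v+V(\Lambda))\cap(w+V(\Lambda))$ is a common facet (an $(n-1)$-dimensional face) of both translates; the set of strict Voronoi vectors is denoted $\mathrm{Vor}(\Lambda)$. For an abelian group $A$ and a finite set $S=-S\subseteq A\setminus\{0\}$, $\mathrm{Cayley}(A,S)$ is the (simple, undirected) graph with vertex set $A$ in which distinct $v,w$ are adjacent iff $v-w\in S$. The Voronoi graph of $\Lambda$ is $\mathrm{Cayley}(\Lambda,\mathrm{Vor}(\Lambda))$. The chromatic number $\chi(G)$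 of a graph $G$ is the least number of colors in a proper vertex coloring. The pairs $v_1,\dots,v_{17}$ of vectors in $\mathbb{Z}^4$ (each $\pm u$ denotes the two-element set $\{u,-u\}$) are: $v_1=\pm(0,0,0,1)$, $v_2=\pm(0,0,1,-1)$, $v_3=\pm(0,0,1,0)$, $v_4=\pm(0,0,1,1)$, $v_5=\pm(0,1,0,0)$, $v_6=\pm(0,1,0,1)$, $v_7=\pm(0,1,1,0)$, $v_8=\pm(0,1,1,1)$, $v_9=\pm(1,-1,0,0)$, $v_{10}=\pm(1,0,0,0)$, $v_{11}=\pm(1,0,0,1)$, $v_{12}=\pm(1,0,1,0)$, $v_{13}=\pm(1,0,1,1)$, $v_{14}=\pm(1,1,0,0)$, $v_{15}=\pm(1,1,0,1)$, $v_{16}=\pm(1,1,1,0)$, $v_{17}=\pm(1,1,1,1)$. *)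

(* Defs.v *)
From HB Require Import structures.
From mathcomp Require Import all_boot all_order all_algebra.
From mathcomp Require Import all_classical all_reals.

Set Implicit Arguments.
Unset Strict Implicit.
Unset Printing Implicit Defensive.

Import Order.TTheory GRing.Theory Num.Theory.

Local Open Scope classical_set_scope.
Local Open Scope ring_scope.

Record sgraph := SGraph {
  vertex :> Type;
  adj : vertex -> vertex -> Prop;
  adj_sym : forall x y, adj x y -> adj y x;
  adj_irrefl : forall x, ~ adj x x
}.

Definition graph_iso (G H : sgraph) : Prop :=
  exists2 f : G -> H, bijective f & forall x y, adj x y <-> adj (f x) (f y).

Definition colorable (G : sgraph) (k : nat) : Prop :=
  exists c : G -> 'I_k, forall x y, adj x y -> c x <> c y.

(* A relation rather than a function, since an infinite graph need not have a
   finite coloring. *)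
Definition has_chromatic_number (G : sgraph) (k : nat) : Prop :=
  colorable G k /\ forall m, colorable G m -> (k <= m)%N.

Section Cayley.
Variables (V : zmodType) (A S : set V).
Hypothesis S_opp : forall u, S u -> S (- u).

Let cayley_adj (x y : A) : Prop := x <> y /\ S (val x - val y).

Let cayley_adj_sym (x y : A) : cayley_adj x y -> cayley_adj y x.
Proof.
by move=> [xy Sxy]; split=> [/esym //|]; rewrite -opprB; exact: S_opp.
Qed.

Let cayley_adj_irrefl (x : A) : ~ cayley_adj x x.
Proof. by case. Qed.

(* The group is given as a subset A of an ambient abelian group V, so that
   lattices in R^n and the whole of Z^4 are treated uniformly; A is meant to be
   a subgroup of V. *)
Definition Cayley : sgraph := SGraph cayley_adj_sym cayley_adj_irrefl.
End Cayley.

Section Voronoi.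
Variables (R : realType) (n : nat).
Implicit Types (x y u v w a : 'rV[R]_n) (L P F : set 'rV[R]_n).

Definition is_lattice L : Prop :=
  exists2 b : n.-tuple 'rV[R]_n, basis_of {:'rV[R]_n} b &
    L = [set x | exists z : 'I_n -> int, x = \sum_(i < n) tnth b i *~ z i].

Definition dot x y : R := \sum_(i < n) x 0 i * y 0 i.

(* The library norm `|x| on row vectors is the sup norm. *)
Definition enorm x : R := Num.sqrt (dot x x).

Definition voronoi_cell L : set 'rV[R]_n :=
  [set x | forall v, L v -> enorm x <= enorm (x - v)].

Definition translate v P : set 'rV[R]_n := [set v + x | x in P].

(* Faces of a convex polyhedron: the subsets on which a linear inequality
   valid on P is tight (a = 0 gives the improper faces set0 and P). *)
Definition is_face P F : Prop :=
  exists a (c : R), (forall x, P x -> dot a x <= c) /\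
    F = [set x | P x /\ dot a x = c].

(* F is nonempty and its affine hull x0 + U has dimension d. *)
Definition has_affine_dim F (d : nat) : Prop :=
  exists x0 (U : {vspace 'rV[R]_n}),
    [/\ F x0,
        forall x, F x -> x - x0 \in U,
        forall W : {vspace 'rV[R]_n},
          (forall x, F x -> x - x0 \in W) -> (U <= W)%VS
      & \dim U = d].

Definition is_facet P F : Prop :=
  is_face P F /\ exists2 d, n = d.+1 & has_affine_dim F d.

Definition Vor L : set 'rV[R]_n :=
  [set u | exists v w, [/\ L v, L w, v <> w, u = v - w &
     let F := translate v (voronoi_cell L) `&` translate w (voronoi_cell L) in
     is_facet (translate v (voronoi_cell L)) F /\
     is_facet (translate w (voronoi_cell L)) F]].

Lemma Vor_opp L u : Vor L u -> Vor L (- u).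
Proof.
move=> [v [w [Lv Lw vw -> [Fv Fw]]]]; exists w, v.
by split=> //; [exact/nesym | rewrite opprB | rewrite setIC].
Qed.

Definition voronoi_graph L : sgraph := @Cayley _ L (Vor L) (@Vor_opp L).

End Voronoi.

Definition vec4 (a b c d : int) : 'rV[int]_4 := \row_(j < 4) [:: a; b; c; d]`_j.

(* One representative of each pair v_1, ..., v_17. *)
Definition vrep (j : nat) : 'rV[int]_4 :=
  match j with
  |  1%N => vec4 0 0 0 1
  |  2%N => vec4 0 0 1 (-1)
  |  3%N => vec4 0 0 1 0
  |  4%N => vec4 0 0 1 1
  |  5%N => vec4 0 1 0 0
  |  6%N => vec4 0 1 0 1
  |  7%N => vec4 0 1 1 0
  |  8%N => vec4 0 1 1 1
  |  9%N => vec4 1 (-1) 0 0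
  | 10%N => vec4 1 0 0 0
  | 11%N => vec4 1 0 0 1
  | 12%N => vec4 1 0 1 0
  | 13%N => vec4 1 0 1 1
  | 14%N => vec4 1 1 0 0
  | 15%N => vec4 1 1 0 1
  | 16%N => vec4 1 1 1 0
  | 17%N => vec4 1 1 1 1
  | _ => 0
  end.

Definition vpair (j : nat) : set 'rV[int]_4 := [set vrep j; - vrep j].

(* The indices j of the pairs v_j whose union is S_i, for 1 <= i <= 16. *)
Definition S_index (i : nat) : seq nat :=
  match i with
  |  1 => [:: 1; 3; 4; 5; 6; 7; 8; 10; 11; 12; 13; 14; 15; 16; 17]
  |  2 => [:: 1; 2; 3; 5; 6; 7; 8; 9; 10; 11; 12; 13; 15; 16; 17]
  |  3 => [:: 1; 3; 4; 5; 6; 7; 8; 9; 10; 11; 12; 13; 15; 16; 17]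
  |  4 => [:: 1; 3; 4; 5; 6; 7; 8; 10; 11; 13; 14; 15; 16; 17]
  |  5 => [:: 1; 2; 3; 5; 6; 7; 8; 9; 10; 11; 12; 13; 16; 17]
  |  6 => [:: 1; 3; 4; 5; 7; 8; 10; 11; 13; 14; 15; 16; 17]
  |  7 => [:: 1; 2; 3; 5; 6; 7; 8; 9; 10; 11; 12; 13; 17]
  |  8 => [:: 1; 3; 4; 5; 7; 8; 10; 11; 13; 14; 16; 17]
  |  9 => [:: 1; 3; 5; 6; 7; 8; 9; 10; 11; 12; 13; 17]
  | 10 => [:: 1; 3; 4; 5; 6; 8; 10; 11; 13; 15; 17]
  | 11 => [:: 1; 3; 4; 5; 7; 8; 10; 11; 13; 17]
  | 12 => [:: 1; 3; 4; 5; 6; 7; 8; 10]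
  | 13 => [:: 1; 3; 4; 5; 7; 8; 10]
  | 14 => [:: 3; 5; 7; 8; 10; 17]
  | 15 => [:: 1; 3; 5; 7; 10]
  | 16 => [:: 1; 3; 5; 10]
  | _ => [::]
  end%N.

Definition S_set (i : nat) : set 'rV[int]_4 :=
  \bigcup_(j in [set` S_index i]) vpair j.

Lemma S_set_opp i u : S_set i u -> S_set i (- u).
Proof.
by move=> [j ji [->|->]]; exists j => //; [right | left; rewrite opprK].
Qed.

Definition G_graph (i : nat) : sgraph :=
  @Cayley _ [set: 'rV[int]_4] (S_set i) (@S_set_opp i).

Definition S_card (i : nat) : nat :=
  (nth 0 [:: 30; 30; 30; 28; 28; 26; 26; 24; 24; 22; 20; 16; 14; 12; 10; 8] i.-1)%N.

Definition G_chi (i : nat) : nat :=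
  (nth 0 [:: 5; 7; 6; 5; 6; 5; 6; 5; 4; 4; 5; 4; 4; 3; 3; 2] i.-1)%N.

(* Main.v *)
Require Import Defs.
From HB Require Import structures.
From mathcomp Require Import all_boot all_order all_algebra.
From mathcomp Require Import all_classical all_reals.
From mathcomp Require Import ring lra zify.

Set Implicit Arguments.
Unset Strict Implicit.
Unset Printing Implicit Defensive.

Import Order.TTheory GRing.Theory Num.Theory.

Local Open Scope ring_scope.

(** The set Vor L is governed by Voronoi's criterion [VorP]: a nonzero lattice
    vector u is a facet vector exactly when u and -u are the only shortest
    vectors of the class u + 2L.  If v is another shortest vector of the class,
    then (u + v)/2 and (u - v)/2 are lattice vectors whose bisectors also contain
    the common face, which is then too small; conversely, if there is none, a
    neighbourhood of u/2 in the bisector of u lies in both cells.  In coordinates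
    with respect to a basis, the Voronoi graph depends only on the positive
    definite quaternary form f, the squared norm, through the vectors of Z^4 that
    are unique minima up to sign modulo 2 ([strict_min]).

    These are easy to find when f is a sum of c_l l(x)^2 with c_l > 0 over a set N
    of integral linear forms.  If |l(v)| <= 1 for all l in N, parity makes
    |l(v)| minimal in the class of v, for each l separately.  Hence v is a
    minimum, and the other minima w are given by |l(w)| = |l(v)| for all l in N, a
    finite problem as soon as N contains a basis of the dual lattice
    ([governed_strict], [governed_tied]).

    Every f has such an expression in a suitable basis.  Cone 1 is spanned by the
    squares of the ten forms x_i and x_i - x_j, the edges of K5.  Cones 2 and 3
    are spanned by nine squares and by the form Q of the root lattice D4, which
    is a sum of four squares in three ways, one for each frame; the nine squares
    are those of three forms from each frame.  A generic form of cone t has the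
    Voronoi vectors S_t, for t = 1, 2, 3.  Among all bases and all three cones,
    take a pair that minimizes the sum of f over S_t.  Passing to the cone on the
    other side of a wall changes this sum by four times a coefficient of f
    ([coef_neighbour]), so that the coefficients of f are nonnegative; this is
    [exists_reduced].  On both sides of the wall of cone 2 opposite to Q the
    Voronoi vectors are the same, and there a symmetry of S_2 settles the sign.

    It remains to see which coefficients vanish.  In cone 1 they form a connected
    graph on five vertices, which exchanges of vertices bring to one of thirty
    normal forms ([classified_K5]).  In cones 2 and 3 with a positive multiple of
    Q, the twelve root pairs S_9 of D4 are always Voronoi vectors, and each frame
    contributes one more pair exactly when its three coefficients are positive
    ([classified_D4]).  Without Q, cone 3 lies in cone 1, and so does cone 2 up to
    a change of basis, unless all its nine coefficients are positive
    ([classified_K33]).  In each case a unimodular matrix identifies the Voronoi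
    vectors with some S_i.

    The graphs are colored by linear maps to Z/m, or to (Z/2)^2 for S_9
    ([colorable_mod]).  For the lower bounds, cliques suffice except for i = 2, 3,
    5, 7, where a subgraph on at most twelve vertices is not colorable with one
    color less, by an exhaustive search through its partitions into color classes
    ([partitionableP]).  Degree and chromatic number together distinguish the
    sixteen graphs. *)

(** * Facets of the Voronoi cell *)

Section Dot.
Variables (R : realType) (n : nat).
Implicit Types (x y z u v w a p : 'rV[R]_n) (L : set 'rV[R]_n).

Lemma dotC x y : dot x y = dot y x.
Proof. by apply: eq_bigr => i _; rewrite mulrC. Qed.

Lemma dot_is_linear a : linear (dot a : 'rV[R]_n -> R^o).
Proof.
move=> k x y; rewrite /dot scaler_sumr -big_split /=.
by apply: eq_bigr => i _; rewrite !mxE mulrDr mulrCA.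
Qed.
HB.instance Definition _ a :=
  GRing.isLinear.Build R 'rV[R]_n R^o _ (dot a) (dot_is_linear a).

Lemma dotDr a x y : dot a (x + y) = dot a x + dot a y.
Proof. exact: raddfD. Qed.
Lemma dotBr a x y : dot a (x - y) = dot a x - dot a y.
Proof. exact: raddfB. Qed.
Lemma dotNr a x : dot a (- x) = - dot a x.
Proof. exact: raddfN. Qed.
Lemma dotZr a k x : dot a (k *: x) = k * dot a x.
Proof. exact: linearZ. Qed.
Lemma dot0r a : dot a 0 = 0.
Proof. exact: raddf0. Qed.
Lemma dotDl x y a : dot (x + y) a = dot x a + dot y a.
Proof. by rewrite dotC dotDr !(dotC a). Qed.
Lemma dotBl x y a : dot (x - y) a = dot x a - dot y a.
Proof. by rewrite dotC dotBr !(dotC a). Qed.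
Lemma dotNl x a : dot (- x) a = - dot x a.
Proof. by rewrite dotC dotNr dotC. Qed.
Lemma dotZl k x a : dot (k *: x) a = k * dot x a.
Proof. by rewrite dotC dotZr dotC. Qed.

Lemma dot_ge0 x : 0 <= dot x x.
Proof. by apply: sumr_ge0 => i _; rewrite -expr2 sqr_ge0. Qed.

Lemma dot_eq0 x : dot x x = 0 -> x = 0.
Proof.
move/eqP; rewrite psumr_eq0 => [/allP z|i _]; last by rewrite -expr2 sqr_ge0.
apply/rowP => i; have := z i (mem_index_enum i).
by rewrite /= -expr2 sqrf_eq0 mxE => /eqP.
Qed.

Lemma dot_gt0 x : x <> 0 -> 0 < dot x x.
Proof. by move=> x0; rewrite lt0r dot_ge0 andbT; apply/eqP => /dot_eq0. Qed.

Lemma enorm_le x y : (enorm x <= enorm y) = (dot x x <= dot y y).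
Proof. by rewrite ler_sqrt ?dot_ge0. Qed.

Lemma voronoi_cellP L x :
  voronoi_cell L x <-> forall p, L p -> 2 * dot x p <= dot p p.
Proof.
have E p : (enorm x <= enorm (x - p)) = (2 * dot x p <= dot p p).
  rewrite enorm_le dotBr !dotBl (dotC p x); apply/idP/idP; lra.
by split=> [V p /V|V p Lp]; [rewrite E | rewrite E V].
Qed.

Definition perp a : {vspace 'rV[R]_n} := lker (linfun (dot a : 'rV[R]_n -> R^o)).

Lemma mem_perp a x : (x \in perp a) = (dot a x == 0).
Proof. by rewrite memv_ker lfunE. Qed.

Lemma dim_perp a : a <> 0 -> n = (\dim (perp a)).+1.
Proof.
move=> a0; set f := linfun (dot a : 'rV[R]_n -> R^o).
have dimn : \dim {: 'rV[R]_n} = n by rewrite dimvf /dim /= mul1n.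
have dim1 : \dim (limg f) = 1%N.
  apply/eqP; rewrite eqn_leq; apply/andP; split.
    by rewrite (leq_trans (dimvS (subvf _))) // dimvf.
  rewrite lt0n dimv_eq0; apply/eqP => im0.
  have : f a \in (0 : {vspace R^o})%VS by rewrite -im0 memv_img ?memvf.
  by rewrite memv0 lfunE /= => /eqP /dot_eq0.
by have := limg_ker_dim f fullv; rewrite capfv -/(perp a) dim1 dimn addn1.
Qed.

Lemma common_radius (T : eqType) (s : seq T) (Q : T -> R -> Prop) :
  (forall t, exists2 e : R, 0 < e & forall d, 0 < d <= e -> Q t d) ->
  exists2 e : R, 0 < e <= 1 & forall t, t \in s -> Q t e.
Proof.
move=> HQ; suff [e e01 He] : exists2 e : R, 0 < e <= 1 &
    forall t d, t \in s -> 0 < d <= e -> Q t d.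
  by exists e => // t ts; apply: He => //; case/andP: e01 => ->/=.
elim: s => [|t s [e /andP[e0 e1] He]]; first by exists 1; rewrite ?ltr01 ?lexx.
have [e' e'0 He'] := HQ t; exists (Num.min e e').
  by rewrite lt_min e0 e'0 ge_min e1.
move=> u d; rewrite inE le_min => /predU1P[->|us] /and3P[d0 de de'].
  by apply: He'; rewrite d0.
by apply: He => //; rewrite d0.
Qed.

(** Voronoi's criterion.  With v = u - 2 p the inequality u.p < p.p says that v is
    longer than u, so that the condition compares u with its class modulo 2 L. *)
Lemma VorP L u :
  L 0 -> (forall x y, L x -> L y -> L (x - y)) ->
  (forall M : R, exists s : seq 'rV[R]_n, forall v, L v -> dot v v <= M -> v \in s) ->
  L u ->
  Vor L u <-> u <> 0 /\ forall p, L p -> p <> 0 -> p <> u -> dot u p < dot p p.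
Proof.
move=> L0 LB Lfin Lu; split.
  move=> [v [w [Lv Lw vw -> [Fv _]]]].
  move: Fv => [_ [d nd [x0 [U [Fx0 _ Umin dimU]]]]].
  set F := (_ `&` _)%classic in Fx0 Umin; set a := v - w.
  have a0 : a <> 0 by move/eqP; rewrite subr_eq0 => /eqP.
  (* Given p with p.p <= u.p, the bisectors of both p and u - p would contain F. *)
  split=> // p Lp p0 pa; rewrite ltNge; apply/negP => le_pa.
  have La : L a by apply: LB.
  have onF x : F x -> 2 * dot (x - w) a = dot a a /\ 2 * dot (x - w) p = dot p p.
    case=> -[y /voronoi_cellP Vy yx] [z /voronoi_cellP Vz zx].
    have zE : x - w = z by rewrite -zx addrC addKr.
    have yE : y = z - a by rewrite /a -zE opprB addrA subrK -yx addrC addKr.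
    rewrite zE; clearbody a; have V1 := Vz a La.
    have V2 := Vy (- a) ltac:(by rewrite -sub0r; apply: LB).
    have V3 := Vz p Lp; have V4 := Vz (a - p) (LB _ _ La Lp).
    move: V1 V2 V3 V4; rewrite yE !(dotBr, dotBl, dotNr, dotNl) (dotC p a).
    by move: le_pa => h0 h1 h2 h3 h4; lra.
  have UE q : q <> 0 -> (forall x, F x -> 2 * dot (x - w) q = dot q q) ->
      U = perp q.
    move=> q0 Hq; apply/eqP; rewrite eqEdim; apply/andP; split.
      apply: Umin => x Fx; rewrite mem_perp dotBr ![dot q _]dotC.
      by have := Hq x Fx; have := Hq x0 Fx0; rewrite !dotBl => h1 h2; apply/eqP; lra.
    by rewrite dimU -ltnS -nd -(dim_perp q0).
  have Ua := UE a a0 (fun x Fx => (onF x Fx).1).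
  have Up := UE p p0 (fun x Fx => (onF x Fx).2).
  (* F spans the hyperplane orthogonal to a and to p, so p is a multiple of a. *)
  have aa := dot_gt0 a0; set t := dot a p / dot a a.
  have pE : p = t *: a.
    have : p - t *: a \in perp p.
      rewrite -Up Ua mem_perp dotBr dotZr /t divfK ?subrr //.
      by rewrite gt_eqF.
    have : p - t *: a \in perp a by rewrite mem_perp dotBr dotZr /t divfK ?subrr // gt_eqF.
    rewrite !mem_perp => /eqP h1 /eqP h2; apply/eqP; rewrite -subr_eq0; apply/eqP.
    by apply: dot_eq0; rewrite {1}dotBl dotZl h1 h2 mulr0 subrr.
  have [h1 h2] := onF x0 Fx0; move: h2; rewrite pE !(dotZl, dotZr) => h2.
  have : t * (t - 1) * dot a a = 0 by rewrite -h1; move: h2; rewrite -h1; lra.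
  move/eqP; rewrite mulf_eq0 (gt_eqF aa) orbF mulf_eq0 => /orP[] /eqP t01.
    by apply: p0; rewrite pE t01 scale0r.
  by apply: pa; rewrite pE (subr0_eq t01) scale1r.
case=> u0 Hu.
have uu := dot_gt0 u0.
(* The cells of 0 and u both contain u/2 + e z for small e: long lattice vectors p
   impose no condition, and finitely many short ones give a positive bound each. *)
have cell0 z : dot u z = 0 -> exists2 e : R, 0 < e &
    voronoi_cell L (2^-1 *: u + e *: z) /\ voronoi_cell L (2^-1 *: u + e *: z - u).
  move=> uz; set M := 2 * dot u u + 8 * dot z z.
  have [s Hs] := Lfin M.
  have [|e /andP[e0 e1] He] := @common_radius _ s (fun p e => L p ->
      dot u p + 2 * (e * dot z p) <= dot p p).
    move=> p; have [->|/eqP p0] := eqVneq p 0.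
      by exists 1 => // d _ _; rewrite !dot0r; lra.
    have [->|/eqP pu] := eqVneq p u.
      by exists 1 => // d _ _; rewrite (dotC z) uz; lra.
    have [Lp|nLp] := pselect (L p); last by exists 1.
    have dp := Hu p Lp p0 pu; set m := dot p p - dot u p.
    have m0 : 0 < m by rewrite subr_gt0.
    have k0 : 0 < 2 * (1 + `|dot z p|) by rewrite mulr_gt0 // ltr_wpDr.
    exists (m / (2 * (1 + `|dot z p|))); first by rewrite divr_gt0.
    move=> d /andP[d0]; rewrite ler_pdivlMr // => dm _.
    have : d * dot z p <= d * `|dot z p| by apply: ler_wpM2l; [exact: ltW | exact: ler_norm].
    move: dm; rewrite /m; lra.
  have half p : L p -> 2 * dot (2^-1 *: u + e *: z) p <= dot p p.
    move=> Lp; rewrite dotDl !dotZl (_ : 2 * _ = dot u p + 2 * (e * dot z p)); last by lra.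
    have [pM|/ltW pM] := leP (dot p p) M; first exact: He (Hs p Lp pM) Lp.
    have q1 := dot_ge0 (2 *: u - p); have q2 := dot_ge0 ((4 * e) *: z - p).
    have e2 : e * e <= 1 by rewrite mulr_ile1 // ltW.
    have := ler_wpM2r (dot_ge0 z) e2.
    move: q1 q2; rewrite !(dotBl, dotBr, dotZl, dotZr) (dotC p u) (dotC p z).
    by move: pM; rewrite /M; nra.
  exists e => //; split; apply/voronoi_cellP => p Lp; first exact: half.
  have Lpu : L (p + u).
    by rewrite -[u]opprK; apply: (LB) => //; rewrite -sub0r; apply: (LB).
  have := half _ Lpu; rewrite !(dotBl, dotBr, dotDl, dotDr, dotZl, dotZr) (dotC z u) uz (dotC p u).
  by move=> h; lra.
have F_ex x : translate u (voronoi_cell L) x <-> voronoi_cell L (x - u).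
  split=> [[y Vy <-]|V]; first by rewrite addrC addKr.
  by exists (x - u) => //; rewrite addrC subrK.
have F_ex0 x : translate 0 (voronoi_cell L) x <-> voronoi_cell L x.
  by split=> [[y Vy <-]|V]; [rewrite add0r | exists x; rewrite ?add0r].
have Lnu : L (- u) by rewrite -sub0r; apply: LB.
exists u, 0; split=> //; first by rewrite subr0.
set F := (_ `&` _)%classic.
have FP x : F x <-> voronoi_cell L (x - u) /\ voronoi_cell L x.
  by rewrite /F /setI /= F_ex F_ex0.
have dimF : exists2 d, n = d.+1 & has_affine_dim F d.
  exists (\dim (perp u)); first exact: dim_perp.
  exists (2^-1 *: u), (perp u); split=> //.
  - apply/FP; have [e _ []] := cell0 0 (dot0r u).
    by rewrite scaler0 addr0.
  - move=> x /FP[/voronoi_cellP V1 /voronoi_cellP V2].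
    have := V1 (- u) Lnu; have := V2 u Lu.
    rewrite mem_perp !(dotBl, dotBr, dotNl, dotNr, dotZr) (dotC x) => h1 h2.
    by apply/eqP; lra.
  - move=> W HW; apply/subvP => z; rewrite mem_perp => /eqP uz.
    have [e e0 [V1 V2]] := cell0 z uz.
    have /HW : F (2^-1 *: u + e *: z) by apply/FP.
    rewrite addrC addKr => zW; rewrite -[z](scalerK (lt0r_neq0 e0)).
    exact: memvZ.
split; split=> //.
- exists (- u), (- (dot u u / 2)); split.
    move=> x /F_ex /voronoi_cellP V; have := V (- u) Lnu.
    by rewrite !(dotBl, dotBr, dotNl, dotNr) (dotC x); lra.
  apply/seteqP; split=> x.
    move=> Fx; split; first by case: Fx.
    move/FP: Fx => [/voronoi_cellP V1 /voronoi_cellP V2].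
    have := V1 (- u) Lnu; have := V2 u Lu.
    by rewrite !(dotBl, dotBr, dotNl, dotNr) (dotC x) => h1 h2; lra.
  case=> /[dup] ? /F_ex /voronoi_cellP V ux; apply/FP; split; first exact/voronoi_cellP.
  apply/voronoi_cellP => p Lp; have := V (p - u) (LB _ _ Lp Lu).
  by move: ux; rewrite !(dotBl, dotBr, dotNl, dotNr) (dotC x u) (dotC p u) => h1 h2; lra.
exists u, (dot u u / 2); split.
  move=> x /F_ex0 /voronoi_cellP V; have := V u Lu.
  by rewrite (dotC x); lra.
apply/seteqP; split=> x.
  move=> Fx; split; first by case: Fx.
  move/FP: Fx => [/voronoi_cellP V1 /voronoi_cellP V2].
  have := V1 (- u) Lnu; have := V2 u Lu.
  by rewrite !(dotBl, dotBr, dotNl, dotNr) (dotC x) => h1 h2; lra.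
case=> /F_ex0 V ux; apply/FP; split=> //.
move/voronoi_cellP: V => V; apply/voronoi_cellP => p Lp.
have Lpu : L (p + u) by rewrite -[u]opprK; apply: LB.
have := V _ Lpu.
by move: ux; rewrite !(dotBl, dotBr, dotDr, dotDl) (dotC x u) (dotC p u) => h1 h2; lra.
Qed.
End Dot.

(** * Integer coordinates of a lattice *)

Notation vec := (int * int * int * int)%type.
Definition quad (T : Type) := (T * T * T * T)%type.

Definition comb (V : zmodType) (b : quad V) (x : vec) : V :=
  let: (b1, b2, b3, b4) := b in let: (x1, x2, x3, x4) := x in
  b1 *~ x1 + b2 *~ x2 + b3 *~ x3 + b4 *~ x4.

Definition pairing (l x : vec) : int :=
  let: (l1, l2, l3, l4) := l in let: (x1, x2, x3, x4) := x in
  l1 * x1 + l2 * x2 + l3 * x3 + l4 * x4.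

Lemma comb_is_zmod_morphism (V : zmodType) (b : quad V) :
  zmod_morphism (comb b).
Proof.
move: b => [[[b1 b2] b3] b4] [[[x1 x2] x3] x4] [[[y1 y2] y3] y4] /=.
by rewrite !mulrzBr !opprD; do 3?[rewrite [RHS]addrACA; congr (_ + _)].
Qed.
HB.instance Definition _ (V : zmodType) (b : quad V) :=
  GRing.isZmodMorphism.Build vec V (comb b) (comb_is_zmod_morphism b).

Lemma pairing_is_zmod_morphism l : zmod_morphism (pairing l).
Proof.
move: l => [[[l1 l2] l3] l4] [[[x1 x2] x3] x4] [[[y1 y2] y3] y4] /=; ring.
Qed.
HB.instance Definition _ l :=
  GRing.isZmodMorphism.Build vec int (pairing l) (pairing_is_zmod_morphism l).

Definition unit_quad : quad vec :=
  ((1, 0, 0, 0), (0, 1, 0, 0), (0, 0, 1, 0), (0, 0, 0, 1))%Z.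

(** The quadruple b g: if g lists the columns of an integral matrix, this is the
    matrix product of the row b with it. *)
Definition rebase (V : zmodType) (b : quad V) (g : quad vec) : quad V :=
  let: (g1, g2, g3, g4) := g in (comb b g1, comb b g2, comb b g3, comb b g4).

Lemma comb_rebase (V : zmodType) (b : quad V) g x :
  comb (rebase b g) x = comb b (comb g x).
Proof.
move: g x => [[[g1 g2] g3] g4] [[[x1 x2] x3] x4].
by rewrite [X in _ = comb b X]/comb !raddfD !raddfMz.
Qed.

Lemma pairMz (A B : zmodType) (p : A * B) n : p *~ n = (p.1 *~ n, p.2 *~ n).
Proof. by rewrite [LHS]surjective_pairing (raddfMz fst) (raddfMz snd). Qed.

Lemma vecMz (a b c d n : int) : (a, b, c, d) *~ n = (a * n, b * n, c * n, d * n).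
Proof. by rewrite !pairMz /= !mulrzz. Qed.

Lemma vecD (a b c d a' b' c' d' : int) :
  (a, b, c, d) + (a', b', c', d') = (a + a', b + b', c + c', d + d') :> vec.
Proof. by []. Qed.

Lemma combE (g : quad vec) x : comb g x =
  let: ((a1, b1, c1, d1), (a2, b2, c2, d2), (a3, b3, c3, d3), (a4, b4, c4, d4)) := g in
  let: (x1, x2, x3, x4) := x in
  (a1 * x1 + a2 * x2 + a3 * x3 + a4 * x4, b1 * x1 + b2 * x2 + b3 * x3 + b4 * x4,
   c1 * x1 + c2 * x2 + c3 * x3 + c4 * x4, d1 * x1 + d2 * x2 + d3 * x3 + d4 * x4).
Proof.
move: g x => [[[[[[a1 b1] c1] d1] [[[a2 b2] c2] d2]] [[[a3 b3] c3] d3]]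
  [[[a4 b4] c4] d4]] [[[x1 x2] x3] x4].
by rewrite /comb !vecMz !vecD.
Qed.

Lemma comb_unit x : comb unit_quad x = x.
Proof.
rewrite combE; move: x => [[[x1 x2] x3] x4] /=.
by congr (_, _, _, _); lia.
Qed.

Definition irange (K : nat) : seq int :=
  [seq n%:Z | n <- iota 0 K.+1] ++ [seq - n%:Z | n <- iota 0 K.+1].

Lemma mem_irange K (x : int) : (`|x| <= K)%N -> x \in irange K.
Proof.
move=> xK; rewrite mem_cat; apply/orP; case: x xK => n nK; [left | right].
  by apply/mapP; exists n; rewrite // mem_iota ltnS.
by apply/mapP; exists n.+1; rewrite ?NegzE // mem_iota ltnS.
Qed.

Definition box (K : nat) : seq vec :=
  [seq (u, d) | u <- [seq (t, c) | t <- [seq (a, b) | a <- irange K, b <- irange K],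
                                   c <- irange K], d <- irange K].

Lemma mem_box K (a b c d : int) :
  (`|a| <= K)%N -> (`|b| <= K)%N -> (`|c| <= K)%N -> (`|d| <= K)%N ->
  (a, b, c, d) \in box K.
Proof.
move=> aK bK cK dK.
by do 3?[apply: (@allpairs_f _ _ _ (fun x y => (x, y))); last exact: mem_irange];
   exact: mem_irange.
Qed.

Section Lattice.
Variable R : realType.
Implicit Types (b : quad 'rV[R]_4) (L : set 'rV[R]_4) (x y w : vec).

Definition sqnorm b x : R := dot (comb b x) (comb b x).

Definition lattice_basis L b : Prop :=
  (forall v, L v <-> exists x, v = comb b x) /\ injective (comb b).

Definition bounded_balls (f : vec -> R) : Prop :=
  forall M, exists s : seq vec, forall x, f x <= M -> x \in s.

(** In particular the coordinate forms of a basis are bounded on balls, whence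
    the discreteness of lattices. *)
Lemma linear_form_bounded (phi : {linear 'rV[R]_4 -> R^o}) (M : R) :
  exists K : nat, forall v, dot v v <= M -> `|phi v| <= K%:R.
Proof.
set C := \sum_(j < 4) (1 + `|M|) * `|phi (delta_mx 0 j)|.
exists (Num.bound C) => v vM; rewrite (le_trans _ (ltW (archi_boundP _))) //; last first.
  by apply: sumr_ge0 => j _; rewrite mulr_ge0 // addr_ge0.
have -> : phi v = \sum_(j < 4) v 0 j * phi (delta_mx 0 j).
  by rewrite {1}[v]row_sum_delta linear_sum; apply: eq_bigr => j _; exact: linearZ.
rewrite (le_trans (ler_norm_sum _ _ _)) //; apply: ler_sum => j _.
rewrite normrM ler_wpM2r //.
have vj : v 0 j ^+ 2 <= M.
  rewrite (le_trans _ vM) // /dot (bigD1 j) //= -expr2 lerDl.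
  by apply: sumr_ge0 => i _; rewrite -expr2 sqr_ge0.
have M0 : 0 <= M by rewrite (le_trans _ vj) ?sqr_ge0.
rewrite (ger0_norm M0) -(ler_pXn2r (n := 2)) ?nnegrE ?addr_ge0 // real_normK ?num_real //.
by rewrite (le_trans vj) // expr2; nra.
Qed.

Lemma lattice_has_basis L : is_lattice L ->
  exists2 b, lattice_basis L b & bounded_balls (sqnorm b).
Proof.
case=> t tbasis ->.
pose e k : 'I_4 := inord k.
pose b : quad 'rV[R]_4 := (tnth t (e 0%N), tnth t (e 1%N), tnth t (e 2%N), tnth t (e 3%N)).
pose z (x : vec) : 'I_4 -> int := fun i => let: (x1, x2, x3, x4) := x in
  nth 0 [:: x1; x2; x3; x4] i.
have combz x : comb b x = \sum_(i < 4) tnth t i *~ z x i.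
  move: x => [[[x1 x2] x3] x4]; rewrite !big_ord_recl big_ord0 addr0 /= !addrA.
  by do 3?[congr (_ + _)]; congr (tnth t _ *~ _); apply/val_inj; rewrite /= inordK.
have coordz i x : coord t i (comb b x) = (z x i)%:~R.
  rewrite combz (eq_bigr (fun i => (z x i)%:~R *: t`_i)) => [|j _]; last first.
    by rewrite scaler_int (tnth_nth 0).
  by rewrite coord_sum_free // (basis_free tbasis).
have eK k : (k < 4)%N -> e k = k :> nat by move=> k4; rewrite /e inordK.
exists b.
  split=> [v|x y xy]; last first.
    have E i : z x i = z y i.
      by apply: (@intr_inj R); rewrite -!coordz xy.
    have := (E (e 0%N), E (e 1%N), E (e 2%N), E (e 3%N)).
    case: x y {xy E} => [[[x1 x2] x3] x4] [[[y1 y2] y3] y4].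
    by rewrite /z !eK //= => -[[[-> ->] ->] ->].
  split=> [[k ->]|[x ->]]; last by exists (z x); rewrite combz.
  exists (k (e 0%N), k (e 1%N), k (e 2%N), k (e 3%N)); rewrite combz.
  apply: eq_bigr => i _; congr (_ *~ _).
  by case: i => [[|[|[|[|//]]]] i4]; congr k; apply: val_inj; rewrite /= eK.
move=> M.
have [K1 H1] := linear_form_bounded (coord t (e 0%N)) M.
have [K2 H2] := linear_form_bounded (coord t (e 1%N)) M.
have [K3 H3] := linear_form_bounded (coord t (e 2%N)) M.
have [K4 H4] := linear_form_bounded (coord t (e 3%N)) M.
exists (box (K1 + K2 + K3 + K4)) => -[[[x1 x2] x3] x4] xM.
have natb (m : int) K : `|m%:~R : R| <= K%:R -> (`|m| <= K)%N.
  by rewrite -intr_norm -[K%:R]/((K : int)%:~R) ler_int; lia.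
have coordK i K : `|(coord t i : _ -> R^o) (comb b (x1, x2, x3, x4))| <= K%:R ->
    (`|z (x1, x2, x3, x4) i| <= K)%N by rewrite coordz => /natb.
move: (coordK _ _ (H1 _ xM)) (coordK _ _ (H2 _ xM)) (coordK _ _ (H3 _ xM))
  (coordK _ _ (H4 _ xM)); rewrite /z !eK //= => h1 h2 h3 h4.
by apply: mem_box; lia.
Qed.

Lemma lattice_basis_rebase L b g h :
  rebase g h = unit_quad -> lattice_basis L b -> injective (comb g) ->
  lattice_basis L (rebase b g).
Proof.
move=> gh [Lb bi] gi; split=> [v|x y]; last by rewrite !comb_rebase => /bi /gi.
rewrite Lb; split=> -[x ->]; last by exists (comb g x); rewrite comb_rebase.
by exists (comb h x); rewrite comb_rebase -[comb g _]comb_rebase gh comb_unit.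
Qed.

Lemma bounded_balls_rebase b g h : rebase h g = unit_quad ->
  bounded_balls (sqnorm b) -> bounded_balls (sqnorm (rebase b g)).
Proof.
move=> hg bb M; have [s Hs] := bb M; exists (map (comb h) s) => x xM.
apply/mapP; exists (comb g x); last by rewrite -comb_rebase hg comb_unit.
by apply: Hs; rewrite /sqnorm -comb_rebase.
Qed.

(** x is, up to sign, the unique minimum of f in its class modulo 2 Z^4. *)
Definition strict_min (f : vec -> R) x : Prop :=
  x <> 0 /\ forall w, x + w *+ 2 <> x -> x + w *+ 2 <> - x -> f x < f (x + w *+ 2).

Lemma Vor_strict_min L b x : lattice_basis L b -> bounded_balls (sqnorm b) ->
  Vor L (comb b x) <-> strict_min (sqnorm b) x.
Proof.
move=> [Lb bi] bb.
have in_L y : L (comb b y) by apply/Lb; exists y.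
have L0 : L 0 by rewrite -(raddf0 (comb b)); exact: in_L.
have LB u v : L u -> L v -> L (u - v).
  by move=> /Lb[y ->] /Lb[z ->]; rewrite -raddfB; exact: in_L.
have Lfin M : exists s : seq 'rV[R]_4, forall v, L v -> dot v v <= M -> v \in s.
  have [s Hs] := bb M; exists (map (comb b) s) => v /Lb[y ->] yM.
  by apply: map_f; apply: Hs.
rewrite (VorP L0 LB Lfin (in_L x)); split=> -[x0 H].
  split=> [x00|w wx wNx]; first by apply: x0; rewrite x00 raddf0.
  have := H (comb b (- w)) (in_L _); rewrite /sqnorm raddfD raddfMn raddfN mulr2n.
  rewrite !(dotDl, dotDr, dotNl, dotNr) (dotC (comb b w) (comb b x)) => {}H.
  have {}H : - dot (comb b x) (comb b w) < - - dot (comb b w) (comb b w).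
    apply: H => [/eqP|/esym E].
      rewrite oppr_eq0 => /eqP E; apply: wx.
      by rewrite (_ : w = 0) ?mul0rn ?addr0 //; apply: bi; rewrite raddf0.
    apply: wNx; have -> : x = - w by apply: bi; rewrite raddfN.
    by rewrite opprK mulr2n addrA addNr add0r.
  by move: H; lra.
split=> [/eqP|p /Lb[w ->] w0 wx].
  by rewrite -(raddf0 (comb b)) => /eqP /bi.
have := H (- w); rewrite /sqnorm raddfD raddfMn raddfN mulr2n.
rewrite !(dotDl, dotDr, dotNl, dotNr) (dotC (comb b w) (comb b x)) => {}H.
have {}H := H _ _; suff [h1 h2] : x + (- w) *+ 2 <> x /\ x + (- w) *+ 2 <> - x.
  by have := H h1 h2; lra.
split=> [/eqP|/eqP].
  rewrite -subr_eq0 addrC addKr mulr2n -opprD oppr_eq0 -mulr2n => /eqP E.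
  apply: w0; suff -> : w = 0 by rewrite raddf0.
  move: E; case: (w) => [[[a c] d] e]; rewrite mulr2n => -[h1 h2 h3 h4].
  by congr (_, _, _, _); lia.
rewrite -subr_eq0 opprK addrAC -mulr2n -mulrnDl => /eqP E.
apply: wx; congr comb; move: E.
case: (w) (x) => [[[a c] d] e] [[[a' c'] d'] e']; rewrite mulr2n => -[h1 h2 h3 h4].
by congr (_, _, _, _); lia.
Qed.
End Lattice.

(** * Unimodular changes of coordinates *)

Definition det4 (l : quad vec) : int :=
  let: ((a1, b1, c1, d1), (a2, b2, c2, d2), (a3, b3, c3, d3), (a4, b4, c4, d4)) := l in
  (a1 * b2 - a2 * b1) * (c3 * d4 - c4 * d3) - (a1 * b3 - a3 * b1) * (c2 * d4 - c4 * d2)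
  + (a1 * b4 - a4 * b1) * (c2 * d3 - c3 * d2) + (a2 * b3 - a3 * b2) * (c1 * d4 - c4 * d1)
  - (a2 * b4 - a4 * b2) * (c1 * d3 - c3 * d1) + (a3 * b4 - a4 * b3) * (c1 * d2 - c2 * d1).

(** The vector that represents the linear form u |-> det (u, l1, l2, l3). *)
Definition cross (l1 l2 l3 : vec) : vec :=
  let det3 a1 b1 c1 a2 b2 c2 a3 b3 c3 : int :=
    a1 * (b2 * c3 - b3 * c2) - a2 * (b1 * c3 - b3 * c1) + a3 * (b1 * c2 - b2 * c1) in
  let: ((a1, b1, c1, d1), (a2, b2, c2, d2), (a3, b3, c3, d3)) := (l1, l2, l3) in
  (det3 b1 c1 d1 b2 c2 d2 b3 c3 d3, - det3 a1 c1 d1 a2 c2 d2 a3 c3 d3,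
   det3 a1 b1 d1 a2 b2 d2 a3 b3 d3, - det3 a1 b1 c1 a2 b2 c2 a3 b3 c3).

Definition adjugate (l : quad vec) : quad vec :=
  let: (l1, l2, l3, l4) := l in
  (cross l2 l3 l4, - cross l1 l3 l4, cross l1 l2 l4, - cross l1 l2 l3).

Definition pairings (l : quad vec) (x : vec) : vec :=
  let: (l1, l2, l3, l4) := l in (pairing l1 x, pairing l2 x, pairing l3 x, pairing l4 x).

(** Cramer's rule: x is recovered from its pairings with four independent forms. *)
Lemma cramer l x : comb (adjugate l) (pairings l x) = x *~ det4 l.
Proof.
move: l x => [[[[[[a1 b1] c1] d1] [[[a2 b2] c2] d2]] [[[a3 b3] c3] d3]]
  [[[a4 b4] c4] d4]] [[[x1 x2] x3] x4].
rewrite combE vecMz /=; congr (_, _, _, _); ring.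
Qed.

Definition transpose (g : quad vec) : quad vec :=
  let: ((a1, b1, c1, d1), (a2, b2, c2, d2), (a3, b3, c3, d3), (a4, b4, c4, d4)) := g in
  ((a1, a2, a3, a4), (b1, b2, b3, b4), (c1, c2, c3, c4), (d1, d2, d3, d4)).

Definition inverse_quad (g : quad vec) : quad vec :=
  let: (h1, h2, h3, h4) := adjugate (transpose g) in
  let d := det4 g in (h1 *~ d, h2 *~ d, h3 *~ d, h4 *~ d).

Definition unimodular (g : quad vec) : Prop :=
  exists2 h, rebase g h = unit_quad & rebase h g = unit_quad.

Definition unimodularb (g : quad vec) : bool :=
  let h := inverse_quad g in (rebase g h == unit_quad) && (rebase h g == unit_quad).

Lemma unimodularbP g : unimodularb g -> unimodular g.
Proof. by case/andP => /eqP gh /eqP hg; exists (inverse_quad g). Qed.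

Lemma rebase_assoc (V : zmodType) (b : quad V) g h :
  rebase (rebase b g) h = rebase b (rebase g h).
Proof.
by move: h => [[[h1 h2] h3] h4]; rewrite /= !comb_rebase.
Qed.

Lemma rebase_unit (V : zmodType) (b : quad V) : rebase b unit_quad = b.
Proof.
move: b => [[[b1 b2] b3] b4].
by rewrite /rebase /comb /= !mulr0z !mulr1z !add0r !addr0.
Qed.

Lemma rebase_unitl g : rebase unit_quad g = g.
Proof. by move: g => [[[g1 g2] g3] g4]; rewrite /rebase !comb_unit. Qed.

Lemma unimodular_rebase g h : unimodular g -> unimodular h -> unimodular (rebase g h).
Proof.
move=> [g' gg' g'g] [h' hh' h'h]; exists (rebase h' g').
  by rewrite rebase_assoc -(rebase_assoc h) hh' rebase_unitl.
by rewrite rebase_assoc -(rebase_assoc g') g'g rebase_unitl.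
Qed.

Lemma unimodular_unit : unimodular unit_quad.
Proof. by exists unit_quad; rewrite rebase_unit. Qed.

Lemma unimodular_inj g : unimodular g -> injective (comb g).
Proof.
move=> [h _ hg] x y xy.
by rewrite -[x]comb_unit -[y]comb_unit -hg !comb_rebase xy.
Qed.

(** * Minima modulo 2 of sums of squares *)

Definition parity (x : vec) : bool * bool * bool * bool :=
  let: (x1, x2, x3, x4) := x in (odd `|x1|, odd `|x2|, odd `|x3|, odd `|x4|).

Lemma odd_abs_diff (x y : int) : odd `|x| = odd `|y| ->
  y = x + (((y - x) %/ 2)%Z + ((y - x) %/ 2)%Z).
Proof. lia. Qed.

Lemma odd_abs_shift (x w : int) : odd `|x + (w + w)| = odd `|x|.
Proof. lia. Qed.

Lemma parityP x y : reflect (exists w, y = x + w *+ 2) (parity x == parity y).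
Proof.
move: x y => [[[x1 x2] x3] x4] [[[y1 y2] y3] y4].
apply: (iffP eqP) => [[h1 h2 h3 h4]|[[[[w1 w2] w3] w4]]].
  exists (((y1 - x1) %/ 2)%Z, ((y2 - x2) %/ 2)%Z, ((y3 - x3) %/ 2)%Z, ((y4 - x4) %/ 2)%Z).
  by congr (_, _, _, _); exact: odd_abs_diff.
by rewrite mulr2n !vecD => -[-> -> -> ->]; congr (_, _, _, _);
   exact/esym/odd_abs_shift.
Qed.

Lemma parity_pairing l x y : parity x = parity y ->
  odd `|pairing l x| = odd `|pairing l y|.
Proof. by move/eqP/parityP => [w ->]; rewrite raddfD raddfMn /= mulr2n; lia. Qed.

(** The sets of vectors in question are closed under opposite; they are listed by
    one representative of each pair. *)
Definition pm (s : seq vec) : seq vec := s ++ [seq - v | v <- s].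

Lemma mem_pm (s : seq vec) x : (x \in pm s) = (x \in s) || (- x \in s).
Proof.
rewrite mem_cat; congr (_ || _); apply/mapP/idP => [[y ys ->]|xs].
  by rewrite opprK.
by exists (- x); rewrite ?opprK.
Qed.

Definition same_abs (N : seq vec) (x y : vec) : bool :=
  all (fun l => `|pairing l x| == `|pairing l y|)%N N.

Definition small (N : seq vec) (x : vec) : bool :=
  all (fun l => `|pairing l x| <= 1)%N N.

(** A pairing of absolute value at most 1 is minimal in absolute value among the
    integers of its parity. *)
Lemma small_le N x y : small N x -> parity x = parity y ->
  {in N, forall l, `|pairing l x| <= `|pairing l y|}%N.
Proof.
by move=> /allP Nx xy l lN; have := Nx l lN; have := parity_pairing l xy; lia.
Qed.

Fixpoint sublists (T : Type) (k : nat) (s : seq T) : seq (seq T) :=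
  match k, s with
  | 0, _ => [:: [::]]
  | _, [::] => [::]
  | k'.+1, x :: s' => [seq x :: t | t <- sublists k' s'] ++ sublists k s'
  end.

Lemma sublists_sub (T : eqType) k (s t : seq T) :
  t \in sublists k s -> {subset t <= s}.
Proof.
elim: s k t => [|x s IH] [|k] t /=; rewrite ?inE //; do ?by move/eqP->.
rewrite mem_cat => /orP[/mapP[u /IH us ->] y|/IH ts y /ts].
  by rewrite !inE => /orP[->//|/us ->]; rewrite orbT.
by rewrite inE orbC => ->.
Qed.

(** The first basis of the dual lattice among the four-element subfamilies of N. *)
Definition unimodular_subfamily (N : seq vec) : option (quad vec) :=
  let q t : quad vec := if t is [:: a; b; c; d] then (a, b, c, d) else (0, 0, 0, 0) in
  ohead [seq q t | t <- sublists 4 N & `|det4 (q t)| == 1%N].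

Lemma unimodular_subfamilyP N l1 l2 l3 l4 :
  unimodular_subfamily N = Some (l1, l2, l3, l4) ->
  [/\ l1 \in N, l2 \in N, l3 \in N & l4 \in N] /\ `|det4 (l1, l2, l3, l4)| = 1%N.
Proof.
rewrite /unimodular_subfamily; set q := (fun t => _); set s := [seq _ <- _ | _].
case E: [seq q t | t <- s] => [//|a r] [aE].
have : a \in [seq q t | t <- s] by rewrite E mem_head.
case/mapP=> t; rewrite mem_filter => /andP[dt /sublists_sub tN] qt.
move: (eqP dt); rewrite -[X in det4 X]/(q t) -qt aE => dl; split=> //.
move: qt dl tN; rewrite aE /q {q s dt E aE a r}.
case: t => [|b1 [|b2 [|b3 [|b4 [|? ?]]]]] [-> -> -> ->] // _ tN.
by split; apply: tN; rewrite !inE eqxx ?orbT.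
Qed.

Definition sign_patterns : seq vec :=
  let s := [:: 1; -1]%Z in
  [seq (u, d) | u <- [seq (t, c) | t <- [seq (a, b) | a <- s, b <- s], c <- s], d <- s].

(** The vectors y with pairing l_i y = +- pairing l_i x, if l is unimodular. *)
Definition sign_images (l : quad vec) (x : vec) : seq vec :=
  let: (p1, p2, p3, p4) := pairings l x in
  [seq comb (adjugate l) (let: (s1, s2, s3, s4) := s in
                          (s1 * p1, s2 * p2, s3 * p3, s4 * p4)) *~ det4 l
  | s <- sign_patterns].

Lemma sign_imagesP l1 l2 l3 l4 x y : `|det4 (l1, l2, l3, l4)| = 1%N ->
  same_abs [:: l1; l2; l3; l4] x y -> y \in sign_images (l1, l2, l3, l4) x.
Proof.
set l := (l1, l2, l3, l4) => dl.
have pick (p q : int) : `|p| == `|q| -> exists2 s, s \in [:: 1; -1]%Z & q = s * p.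
  move=> pq; have /orP[] : (q == p) || (q == - p) by lia.
    by move/eqP->; exists 1%Z; rewrite ?mul1r.
  by move/eqP->; exists (-1)%Z; rewrite ?mulN1r.
case/and5P=> /pick[s1 h1 e1] /pick[s2 h2 e2] /pick[s3 h3 e3] /pick[s4 h4 e4] _.
apply/mapP; exists (s1, s2, s3, s4).
  by do 3?[apply: (@allpairs_f _ _ _ (fun x y => (x, y))) => //].
rewrite -e1 -e2 -e3 -e4 -[RHS]/(comb (adjugate l) (pairings l y) *~ det4 l).
rewrite cramer -mulrzA (_ : _ * _ = 1) ?mulr1z //; lia.
Qed.

(** Sufficient for x to be determined up to sign by its pairings with N up to sign. *)
Definition rigid (N : seq vec) (x : vec) : bool :=
  if unimodular_subfamily N is Some l then
    all (fun y => same_abs N x y ==> (y \in [:: x; - x])) (sign_images l x)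
  else false.

Lemma rigidP N x y : rigid N x -> same_abs N x y -> y \in [:: x; - x].
Proof.
rewrite /rigid; case E: (unimodular_subfamily N) => [[[[l1 l2] l3] l4]|//].
have [[n1 n2 n3 n4] d1] := unimodular_subfamilyP E.
move=> /allP H Nxy; apply: (implyP (H y _)) => //; apply: sign_imagesP => //.
by move/allP: Nxy => Nxy; apply/and5P; split=> //; exact: Nxy.
Qed.

(** For f governed by N (see [governed] below), [strictb] and [tiedb] certify that
    x is, respectively is not, a unique minimum of its class up to sign. *)
Definition strictb (N : seq vec) (x : vec) : bool := small N x && rigid N x.

Definition tiedb (N : seq vec) (x : vec) : bool :=
  small N x && if unimodular_subfamily N is Some l then
    has (fun y => [&& parity x == parity y, y \notin [:: x; - x] & same_abs N x y])
      (sign_images l x)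
  else false.

Section Governed.
Variable R : realType.
Implicit Types (f : vec -> R) (N : seq vec).

(** The only property of a sum of squares of the forms in N with positive
    coefficients that matters here. It does not refer to the coefficients, so the
    certificates above need only know which of them vanish. *)
Definition governed N f : Prop := forall x y,
  {in N, forall l, `|pairing l x| <= `|pairing l y|}%N ->
  f x <= f y /\ (~~ same_abs N x y -> f x < f y).

Definition square_sum (s : seq (R * vec)) (x : vec) : R :=
  \sum_(cl <- s) cl.1 * ((pairing cl.2 x)%:~R) ^+ 2.

Lemma governed_square_sum s N f :
  (forall x, f x = square_sum s x) ->
  (forall cl, cl \in s -> 0 <= cl.1) ->
  (forall cl, cl \in s -> cl.1 != 0 -> cl.2 \in N) ->
  (forall l, l \in N -> exists2 c : R, 0 < c & (c, l) \in s) ->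
  governed N f.
Proof.
move=> fE s0 sN Ns x y xy.
have sqE (z : vec) l : ((pairing l z)%:~R ^+ 2 : R) = (`|pairing l z| ^ 2)%N%:R.
  by rewrite natrX natr_absz intr_norm real_normK // num_real.
have le_term cl : cl \in s ->
    cl.1 * ((pairing cl.2 x)%:~R) ^+ 2 <= cl.1 * ((pairing cl.2 y)%:~R) ^+ 2.
  move=> cls; have [->|c0] := eqVneq cl.1 0; first by rewrite !mul0r.
  by rewrite ler_wpM2l ?s0 // !sqE ler_nat leq_exp2r // xy ?sN.
rewrite !fE; split; first by rewrite /square_sum !big_seq; apply: ler_sum.
case/allPn=> l lN lxy; have [c c0 cs] := Ns l lN.
rewrite /square_sum (big_rem _ cs) [X in _ < X](big_rem _ cs) /=.
apply: ltr_leD.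
  by rewrite ltr_pM2l // !sqE ltr_nat ltn_exp2r // ltn_neqAle lxy xy.
rewrite !big_seq; apply: ler_sum => cl /mem_rem; exact: le_term.
Qed.

Lemma governed_strict N f x : governed N f -> x <> 0 -> strictb N x -> strict_min f x.
Proof.
move=> gf x0 /andP[Nx rx]; split=> // w /eqP wx /eqP wNx.
have xy : parity x = parity (x + w *+ 2) by apply/eqP/parityP; exists w.
apply: (gf _ _ (small_le Nx xy)).2; apply/negP => /(rigidP rx).
by rewrite !inE (negPf wx) (negPf wNx).
Qed.

Lemma governed_even N f x : governed N f -> f (- x) = f x.
Proof.
move=> gf; apply/eqP; rewrite eq_le; apply/andP.
by split; apply: (gf _ _ _).1 => l _; rewrite raddfN abszN.
Qed.

Lemma strict_min_opp f x : (forall y, f (- y) = f y) -> strict_min f x ->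
  strict_min f (- x).
Proof.
move=> fN [x0 H]; split=> [/eqP|w]; first by rewrite oppr_eq0 => /eqP.
rewrite opprK => wx wNx; rewrite fN -[f (- x + _)]fN opprD opprK -mulNrn.
by apply: H => E; [apply: wx | apply: wNx]; rewrite -[LHS]opprK opprD opprK -mulNrn E ?opprK.
Qed.

(** If z is tied with x, the minimum of the class is attained at x and at z, which
    are not opposite; hence nowhere uniquely. *)
Lemma governed_tied N f x y : governed N f -> tiedb N x -> parity x = parity y ->
  ~ strict_min f y.
Proof.
move=> gf /andP[Nx]; case: (unimodular_subfamily N) => // l /hasP[z _ /and3P[/eqP xz zx Nxz]].
move=> xy [y0 H].
have fxz : f z = f x.
  move/allP: Nxz => Nxz; apply/eqP; rewrite eq_le; apply/andP.
  by split; apply: (gf _ _ _).1 => l' /Nxz /eqP ->.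
have fxy : f x <= f y := (gf _ _ (small_le Nx xy)).1.
have strict t : parity y = parity t -> t \notin [:: y; - y] -> f y < f t.
  move=> /eqP/parityP[w ->]; rewrite !inE negb_or => /andP[/eqP h1 /eqP h2]; exact: H.
have [yx|yx] := boolP (x \in [:: y; - y]); last first.
  by have := strict x (esym xy) yx; rewrite ltNge fxy.
have : f y < f z.
  apply: strict; first by rewrite -xy.
  move: yx zx; rewrite !inE => /orP[] /eqP ->; rewrite ?opprK //.
  by rewrite orbC.
have -> : f y = f x by move: yx; rewrite !inE => /orP[] /eqP ->; rewrite ?(governed_even _ gf).
by rewrite fxz ltxx.
Qed.

(** V represents all nonzero classes modulo 2. *)
Definition all_classes (V : seq vec) : bool :=
  all (fun a => all (fun b => all (fun c => all (fun d =>
    ((a, b, c, d) == (false, false, false, false)) ||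
    has (fun v => parity v == (a, b, c, d)) V)
  [:: false; true]) [:: false; true]) [:: false; true]) [:: false; true].

(** Each nonzero class contains at most one pair of unique minima, and the class of
    0 contains none since 0 itself is shorter; so it suffices to decide about one
    minimum v in each class. *)
Lemma strict_min_list f (V S : seq vec) :
  (forall x, f (- x) = f x) -> (forall x, f 0 <= f x) ->
  all_classes V -> {subset S <= V} ->
  (forall v, v \in S -> strict_min f v) ->
  (forall v y, v \in V -> v \notin S -> parity v = parity y -> ~ strict_min f y) ->
  forall x, strict_min f x <-> x \in pm S.
Proof.
move=> fN f0 Vall SV Sstrict Stied x; split; last first.
  rewrite mem_pm => /orP[/Sstrict//|/Sstrict /(strict_min_opp fN)].
  by rewrite opprK.
move=> sx; have b2 (b : bool) : b \in [:: false; true] by case: b.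
have [px|px] := eqVneq (parity x) (parity 0).
  move/esym/eqP/parityP: px => [w xw]; case: sx => x0 /(_ (- w)).
  have -> : x + (- w) *+ 2 = 0 by rewrite {1}xw add0r mulNrn subrr.
  move=> H; suff : f x < f 0 by rewrite ltNge f0.
  apply: H => [/esym //|/esym/eqP]; by rewrite oppr_eq0 => /eqP.
have [v vV /eqP vx] : exists2 v, v \in V & parity v == parity x.
  move: px; case: (parity x) => [[[a b] c] d] px.
  move/allP: Vall => /(_ a (b2 a)) /allP /(_ b (b2 b)) /allP /(_ c (b2 c)) /allP /(_ d (b2 d)).
  by rewrite -[(false, false, false, false)]/(parity 0) (negPf px) /= => /hasP.
have [vS|vS] := boolP (v \in S); last by case: (Stied v x).
rewrite mem_pm; apply/negP => /negP; rewrite negb_or => /andP[xS NxS].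
case: sx => _ Hx; case: (Sstrict v vS) => _ Hv.
have [w xE] := parityP _ _ (introT eqP vx).
have xv : x <> v by move=> E; rewrite E vS in xS.
have xNv : x <> - v by move=> E; rewrite E opprK vS in NxS.
have := Hv w; rewrite -xE => /(_ xv xNv) ltvx.
have := Hx (- w); have -> : x + (- w) *+ 2 = v by rewrite {1}xE mulNrn addrK.
move=> H; suff : f x < f v by move/(lt_trans ltvx); rewrite ltxx.
by apply: H => [/esym //|E]; apply: xNv; rewrite E opprK.
Qed.
End Governed.

(** * Reduction of quaternary forms to three simplicial cones *)

Definition vec_rep (j : nat) : vec :=
  match j with
  | 1 => (0, 0, 0, 1)%Z
  | 2 => (0, 0, 1, -1)%Z
  | 3 => (0, 0, 1, 0)%Z
  | 4 => (0, 0, 1, 1)%Z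
  | 5 => (0, 1, 0, 0)%Z
  | 6 => (0, 1, 0, 1)%Z
  | 7 => (0, 1, 1, 0)%Z
  | 8 => (0, 1, 1, 1)%Z
  | 9 => (1, -1, 0, 0)%Z
  | 10 => (1, 0, 0, 0)%Z
  | 11 => (1, 0, 0, 1)%Z
  | 12 => (1, 0, 1, 0)%Z
  | 13 => (1, 0, 1, 1)%Z
  | 14 => (1, 1, 0, 0)%Z
  | 15 => (1, 1, 0, 1)%Z
  | 16 => (1, 1, 1, 0)%Z
  | 17 => (1, 1, 1, 1)%Z
  | _ => (0, 0, 0, 0)%Z
  end.

Definition reps (i : nat) : seq vec := map vec_rep (S_index i).

(** The edges of K5 with vertices 0, ..., 4, in the order 01, 02, 03, 04, 12, 13,
    ..., 34: edge ij is the form x_i - x_j up to sign, where x_0 = 0. *)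
Definition edge_forms : seq vec :=
  [:: (1, 0, 0, 0); (0, 1, 0, 0); (0, 0, 1, 0); (0, 0, 0, 1); (1, -1, 0, 0);
      (1, 0, -1, 0); (1, 0, 0, -1); (0, 1, -1, 0); (0, 1, 0, -1); (0, 0, 1, -1)]%Z.

(** The twelve linear forms, up to sign, that are at most 1 in absolute value on
    the roots S_9 split into three frames; the squares over each frame add up to the
    same form Q, the form of D4. *)
Definition frame (j : nat) : seq vec :=
  match j with
  | 0 => [:: (0, 0, 1, -1); (1, 1, -1, -1); (0, 1, 0, 0); (1, 0, 0, 0)]%Z
  | 1 => [:: (1, 1, -1, 0); (0, 0, 1, 0); (0, 1, 0, -1); (1, 0, 0, -1)]%Z
  | _ => [:: (1, 1, 0, -1); (0, 0, 0, 1); (0, 1, -1, 0); (1, 0, -1, 0)]%Z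
  end.

(** In frame j, cone t omits the form at this position. *)
Definition omitted (t j : nat) : nat := ((t == 3) && (j == 0))%N.

Definition triple (t j : nat) : seq vec :=
  let o := omitted t j in take o (frame j) ++ drop o.+1 (frame j).

(** Cone 1 is spanned by the squares of its ten forms.  Cones 2 and 3 are spanned
    by the squares of their nine forms and by Q.  The forms of cone 3 are the edges
    of K5 other than 12; those of cone 2 represent the bond matroid of K_{3,3}. *)
Definition forms (t : nat) : seq vec :=
  if t is 1 then edge_forms else triple t 0 ++ triple t 1 ++ triple t 2.

(** Entry k describes the cone across the wall of cone t opposite to ray k, by its
    kind 1, 2 or 3 and by the columns of a change of coordinates.  Cone 2 has no entry for
    its ray Q, since crossing that wall does not change the Voronoi vectors. *)
Definition neighbours (t : nat) : seq (nat * quad vec) :=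
  match t with
  | 1 => [:: (3%N, ((1, 1, 1, 1), (-1, 0, 0, 0), (0, 0, 0, -1), (0, 0, -1, 0)));
      (3%N, ((0, 1, 0, 0), (-1, -1, -1, -1), (0, 0, 0, 1), (0, 0, 1, 0)));
      (3%N, ((0, 0, 1, 0), (-1, -1, -1, -1), (0, 0, 0, 1), (0, 1, 0, 0)));
      (3%N, ((0, 0, 0, 1), (-1, -1, -1, -1), (0, 0, 1, 0), (0, 1, 0, 0)));
      (3%N, ((0, 1, 0, 0), (1, 0, 0, 0), (0, 0, 0, 1), (0, 0, 1, 0)));
      (3%N, ((0, 0, 1, 0), (1, 0, 0, 0), (0, 0, 0, 1), (0, 1, 0, 0)));
      (3%N, ((0, 0, 0, 1), (1, 0, 0, 0), (0, 0, 1, 0), (0, 1, 0, 0)));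
      (3%N, ((0, 0, 1, 0), (0, 1, 0, 0), (0, 0, 0, 1), (-1, -1, -1, -1)));
      (3%N, ((0, 0, 0, 1), (0, 1, 0, 0), (0, 0, 1, 0), (-1, -1, -1, -1)));
      (3%N, ((0, 0, 0, 1), (0, 0, 1, 0), (0, 1, 0, 0), (-1, -1, -1, -1)))]%Z
  | 2 => [:: (3%N, ((0, 1, 0, 0), (1, 0, 0, 0), (0, 0, 0, 1), (0, 0, 1, 0)));
      (3%N, ((0, 1, 0, 0), (1, 1, 1, 1), (0, -1, -1, 0), (0, -1, 0, -1)));
      (3%N, ((1, 1, 1, 1), (1, 0, 0, 0), (0, -1, 0, 0), (-1, 0, -1, 0)));
      (3%N, ((0, 1, 1, 0), (1, 0, 1, 0), (0, 0, 0, 1), (0, 0, -1, 0)));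
      (3%N, ((0, 0, 0, 1), (0, -1, -1, 0), (0, 1, 0, 0), (1, 0, 1, 0)));
      (3%N, ((0, 0, 0, 1), (-1, 0, -1, 0), (0, 1, 1, 0), (0, -1, 0, -1)));
      (3%N, ((0, 1, 0, 1), (1, 0, 0, 1), (0, 0, 0, -1), (0, 0, 1, 0)));
      (3%N, ((0, 0, 1, 0), (0, -1, 0, -1), (0, 1, 0, 0), (-1, 0, -1, 0)));
      (3%N, ((0, 0, 1, 0), (-1, 0, 0, -1), (0, -1, -1, 0), (0, 1, 0, 1)))]%Z
  | 3 => [:: (2%N, ((0, 0, 0, 1), (0, 0, 1, 0), (0, 1, 0, 0), (1, 0, 0, 0)));
      (3%N, ((0, 1, 0, 0), (1, 1, 1, 1), (0, -1, -1, 0), (0, -1, 0, -1)));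
      (3%N, ((1, 1, 1, 1), (1, 0, 0, 0), (0, -1, 0, 0), (-1, 0, -1, 0)));
      (2%N, ((0, 0, 0, 1), (0, 0, -1, 0), (0, 1, 1, 0), (1, 0, 1, 0)));
      (3%N, ((0, 0, 0, 1), (0, -1, 0, 0), (0, 1, 1, 0), (-1, 0, -1, -1)));
      (3%N, ((0, 0, 0, 1), (-1, 0, 0, 0), (0, -1, -1, -1), (0, 1, 0, 0)));
      (2%N, ((0, 0, 0, 1), (0, 0, -1, 0), (0, -1, 0, -1), (-1, 0, 0, -1)));
      (3%N, ((0, 0, 1, 0), (0, -1, 0, 0), (0, 1, 0, 1), (-1, 0, -1, -1)));
      (3%N, ((0, 0, 1, 0), (-1, 0, 0, 0), (0, -1, -1, -1), (0, 1, 0, 0)));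
      (1%N, ((0, 0, 0, 1), (0, 0, 1, 0), (0, 1, 0, 0), (-1, -1, -1, -1)))]%Z
  | _ => [::]
  end.
Definition neighbour (t k : nat) := nth (0%N, unit_quad) (neighbours t) k.

(** A linear functional on forms: the sum of the values of f over the first list
    minus that over the second. *)
Definition functional := (seq vec * seq vec)%type.

(** The functional of a wall is the difference between the sums of f over the
    Voronoi vectors of the two cones.  For the ray Q of cone 2, f(e1 + e2) -
    f(e1 - e2) - f(e3 + e4) + f(e3 - e4) vanishes on the other nine rays. *)
Definition walls (t : nat) : seq functional :=
  [seq ([seq comb ng.2 v | v <- reps ng.1], reps t) | ng <- neighbours t] ++
  (if t == 2 then [:: ([:: (1, 1, 0, 0); (0, 0, 1, -1)], [:: (1, -1, 0, 0); (0, 0, 1, 1)])]%Z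
   else [::]).

Definition monomials (x : vec) : seq int :=
  let: (x1, x2, x3, x4) := x in
  [:: x1 * x1; x1 * x2; x1 * x3; x1 * x4; x2 * x2; x2 * x3; x2 * x4;
      x3 * x3; x3 * x4; x4 * x4].

Definition square_coefs (l : vec) : seq int :=
  let: (l1, l2, l3, l4) := l in
  [:: l1 * l1; 2 * l1 * l2; 2 * l1 * l3; 2 * l1 * l4; l2 * l2; 2 * l2 * l3; 2 * l2 * l4;
      l3 * l3; 2 * l3 * l4; l4 * l4].

Definition sumz (s : seq int) : int := foldr +%R 0 s.

Lemma sumzE s : sumz s = \sum_(x <- s) x.
Proof. by rewrite /sumz foldrE. Qed.

Definition column_sums (T : Type) (F : T -> seq int) (s : seq T) : seq int :=
  [seq sumz [seq (F v)`_k | v <- s] | k <- iota 0 10].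

Lemma nth_column_sums (T : Type) (F : T -> seq int) s k : (k < 10)%N ->
  (column_sums F s)`_k = \sum_(v <- s) (F v)`_k.
Proof.
by move=> k10; rewrite (nth_map 0%N) ?size_iota // nth_iota // sumzE big_map.
Qed.

(** The functional in coordinates: its value on f is the scalar product with the ten
    coefficients of f. *)
Definition moment (ab : functional) : seq int :=
  let p := column_sums monomials ab.1 in let q := column_sums monomials ab.2 in
  [seq p`_k - q`_k | k <- iota 0 10].

Definition rays (t : nat) : seq (seq int) :=
  map square_coefs (forms t) ++ (if t == 1 then [::] else [:: column_sums square_coefs (frame 0)]).

(** The rays and the wall functionals of cone t are dual bases up to a factor 4, so
    the walls compute the coefficients of a form with respect to the rays. *)
Definition dual_walls (t : nat) : bool :=
  let h := map moment (walls t) in let r := rays t in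
  (size h == 10) && all (fun i => all (fun j =>
    sumz [seq (nth [::] r k)`_i * (nth [::] h k)`_j | k <- iota 0 10] == (if i == j then 4 else 0))
    (iota 0 10)) (iota 0 10).

Lemma dual_walls_K5 : dual_walls 1. Proof. by vm_compute. Qed.
Lemma dual_walls_K33 : dual_walls 2. Proof. by vm_compute. Qed.
Lemma dual_walls_K5e : dual_walls 3. Proof. by vm_compute. Qed.
Lemma frames_agree :
  all (fun j => column_sums square_coefs (frame j) == column_sums square_coefs (frame 0)) (iota 0 3).
Proof. by vm_compute. Qed.

Lemma neighbours_unimodular :
  all (fun t => all (fun ng => (ng.1 \in iota 1 3) && unimodularb ng.2) (neighbours t)) (iota 1 3).
Proof. by vm_compute. Qed.

Lemma dual_wallsP (t : nat) i j : dual_walls t -> (i < 10)%N -> (j < 10)%N ->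
  \sum_(k < 10) (nth [::] (rays t) k)`_i * (nth [::] (map moment (walls t)) k)`_j =
  if i == j then 4 else 0.
Proof.
move=> /andP[_ /allP /(_ i) H] i10 j10; move: H; rewrite mem_iota i10 => /(_ isT) /allP /(_ j).
rewrite mem_iota j10 => /(_ isT) /eqP <-.
by rewrite sumzE big_map -[iota 0 10]/(index_iota 0 10) big_mkord.
Qed.

Lemma square_coefsE l x :
  \sum_(i < 10) (square_coefs l)`_i * (monomials x)`_i = pairing l x ^+ 2.
Proof.
move: l x => [[[l1 l2] l3] l4] [[[x1 x2] x3] x4].
by rewrite !big_ord_recl big_ord0 /=; ring.
Qed.

Lemma frame_coefsE j x : (j < 3)%N ->
  \sum_(i < 10) (column_sums square_coefs (frame 0))`_i * (monomials x)`_i =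
  \sum_(l <- frame j) pairing l x ^+ 2.
Proof.
move=> j3; have /eqP <- := allP frames_agree j ltac:(by rewrite mem_iota).
under eq_bigr => i _ do rewrite nth_column_sums // big_distrl /=.
by rewrite exchange_big /=; apply: eq_bigr => l _; rewrite square_coefsE.
Qed.

Lemma seq_argmin (R : realDomainType) (T : eqType) (s : seq T) (P : T -> Prop) (F : T -> R) x0 :
  x0 \in s -> P x0 -> exists2 x, P x & forall y, y \in s -> P y -> F x <= F y.
Proof.
move=> x0s P0; pose p := [pred x | `[<P x>]].
suff [x xs xmin] : exists2 x, x \in [seq x <- s | p x] & forall y, y \in [seq x <- s | p x] -> F x <= F y.
  move: xs; rewrite mem_filter => /andP[/asboolP Px _]; exists x => // y ys Py.
  by apply: xmin; rewrite mem_filter ys andbT; apply/asboolP.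
have : x0 \in [seq x <- s | p x] by rewrite mem_filter x0s andbT; apply/asboolP.
move: [seq x <- s | p x] => r; elim: r x0 {x0s P0} => // a r IH x0 _.
case: r IH => [|a' r] IH.
  by exists a => [|y]; rewrite !inE // => /eqP->.
have [x xr xmin] := IH a' (mem_head _ _).
have [le_ax|/ltW le_xa] := leP (F a) (F x).
  exists a; first exact: mem_head.
  by move=> y; rewrite inE => /predU1P[->//|/xmin]; apply: le_trans.
exists x; first by rewrite inE xr orbT.
by move=> y; rewrite inE => /predU1P[->//|/xmin].
Qed.

Section Reduction.
Variable R : realType.
Implicit Types (b : quad 'rV[R]_4) (t : nat) (g : quad vec) (A : functional).

(** The coefficients of the squared norm with respect to [monomials]. *)
Definition gram b : seq R :=
  let: (b1, b2, b3, b4) := b in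
  [:: dot b1 b1; 2 * dot b1 b2; 2 * dot b1 b3; 2 * dot b1 b4; dot b2 b2;
      2 * dot b2 b3; 2 * dot b2 b4; dot b3 b3; 2 * dot b3 b4; dot b4 b4].

Definition eval (c : seq R) (m : seq int) : R := \sum_(k < 10) c`_k * (m`_k)%:~R.

Lemma sqnorm_gram b x : sqnorm b x = eval (gram b) (monomials x).
Proof.
move: b x => [[[b1 b2] b3] b4] [[[x1 x2] x3] x4].
rewrite /sqnorm /comb /eval !big_ord_recl big_ord0 /= -!scaler_int.
rewrite !(dotDl, dotDr, dotZl, dotZr) (dotC b2 b1) (dotC b3 b1) (dotC b4 b1).
rewrite (dotC b3 b2) (dotC b4 b2) (dotC b4 b3) !intrM; ring.
Qed.

Lemma sqnorm_rebase b g x : sqnorm (rebase b g) x = sqnorm b (comb g x).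
Proof. by rewrite /sqnorm comb_rebase. Qed.

Lemma sqnorm_ge0 b x : 0 <= sqnorm b x.
Proof. exact: dot_ge0. Qed.

Definition value b A : R := \sum_(v <- A.1) sqnorm b v - \sum_(v <- A.2) sqnorm b v.

Lemma value_moment b A : value b A = eval (gram b) (moment A).
Proof.
rewrite /value /eval.
under eq_bigr => v _ do rewrite sqnorm_gram /eval.
under [X in _ - X]eq_bigr => v _ do rewrite sqnorm_gram /eval.
rewrite exchange_big [X in _ - X]exchange_big -sumrB; apply: eq_bigr => k _ /=.
rewrite (nth_map 0%N) ?size_iota // nth_iota // add0n !nth_column_sums // intrB mulrBr !rmorph_sum.
by rewrite !mulr_sumr.
Qed.

(** The potential that the reduction minimizes. *)
Definition weight t b : R := \sum_(v <- reps t) sqnorm b v.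

Definition minimal t b : Prop := forall t' g,
  t' \in iota 1 3 -> unimodular g -> weight t b <= weight t' (rebase b g).

Lemma minimal_rebase t b t' g : minimal t b -> unimodular g ->
  weight t' (rebase b g) = weight t b -> minimal t' (rebase b g).
Proof.
move=> mtb ug wE t2 g2 t2C ug2; rewrite wE rebase_assoc.
by apply: mtb => //; apply: unimodular_rebase.
Qed.

Lemma weight_rebase t b g :
  weight t (rebase b g) = \sum_(v <- [seq comb g v | v <- reps t]) sqnorm b v.
Proof. by rewrite big_map; apply: eq_bigr => v _; rewrite sqnorm_rebase. Qed.

(** The unit vectors belong to S_1, S_2 and S_3, so a bound on the weight bounds the
    norms of the basis vectors, and finitely many bases compete. *)
Lemma exists_minimal b : bounded_balls (sqnorm b) ->
  exists t g, [/\ t \in iota 1 3, unimodular g & minimal t (rebase b g)].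
Proof.
move=> bb; have [K HK] := bb (weight 1 b).
pose quads := [seq (p, v4) | p <- [seq (q, v3) | q <- [seq (v1, v2) | v1 <- K, v2 <- K],
  v3 <- K], v4 <- K].
pose F (tg : nat * quad vec) := weight tg.1 (rebase b tg.2).
have [||[t g] [tC ug] tg_min] := @seq_argmin R (nat * quad vec)%type
    ((1%N, unit_quad) :: [seq (t, g) | t <- iota 1 3, g <- quads])
    (fun tg => tg.1 \in iota 1 3 /\ unimodular tg.2) F (1%N, unit_quad).
- by rewrite mem_head.
- by split=> //; apply: unimodular_unit.
exists t, g; split=> // t' g' t'C ug'; rewrite rebase_assoc.
have ugg := unimodular_rebase ug ug'; move: (rebase g g') ugg => {ug'}g' ug'.
rewrite -[weight t _]/(F (t, g)) -[weight t' _]/(F (t', g')).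
have [big|lt1] := leP (weight 1 b) (F (t', g')).
  rewrite (le_trans _ big) //.
  have <- : F (1%N, unit_quad) = weight 1 b by rewrite /F rebase_unit.
  by apply: tg_min; [exact: mem_head | split=> //; exact: unimodular_unit].
apply: tg_min => //; rewrite in_cons; apply/orP; right.
have in_box v : v \in reps t' -> comb g' v \in K.
  move=> vr; apply/HK; rewrite (le_trans _ (ltW lt1)) //.
  rewrite /F /weight (big_rem _ vr) /= sqnorm_rebase lerDl.
  by apply: sumr_ge0 => w _; exact: sqnorm_ge0.
have units : {subset [:: (1, 0, 0, 0); (0, 1, 0, 0); (0, 0, 1, 0); (0, 0, 0, 1)]%Z <= reps t'}.
  by apply/allP; move: t'C; rewrite !inE => /or3P[] /eqP->; vm_compute.
apply: (@allpairs_f _ _ _ (fun x y => (x, y))) => //.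
have combu : rebase g' unit_quad = g' := rebase_unit g'.
move: combu; rewrite /rebase /unit_quad; move: g' {ug' lt1} in_box => [[[g1 g2] g3] g4] in_box.
case=> e1 e2 e3 e4; have in_units v : v \in _ -> _ := fun h => in_box v (units v h).
apply: (@allpairs_f _ _ _ (fun x y => (x, y))); last by rewrite -e4; exact: (in_units (0, 0, 0, 1)%Z).
apply: (@allpairs_f _ _ _ (fun x y => (x, y))); last by rewrite -e3; exact: (in_units (0, 0, 1, 0)%Z).
by apply: (@allpairs_f _ _ _ (fun x y => (x, y)));
  [rewrite -e1; exact: (in_units (1, 0, 0, 0)%Z)
  | rewrite -e2; exact: (in_units (0, 1, 0, 0)%Z)].
Qed.

(** Expansion of f with respect to the rays, by duality. *)
Lemma ray_expansion t b x : dual_walls t ->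
  4 * sqnorm b x = \sum_(k < 10) value b (nth ([::], [::]) (walls t) k) *
    (\sum_(i < 10) (nth [::] (rays t) k)`_i * (monomials x)`_i)%:~R.
Proof.
move=> dt; set r := fun k => nth [::] (rays t) k.
have sz : size (walls t) = 10%N by move/andP: dt => [/eqP + _]; rewrite size_map.
under eq_bigr => k _ do rewrite value_moment /eval rmorph_sum big_distrlr /=.
rewrite exchange_big; under eq_bigr => j _ do rewrite exchange_big.
rewrite exchange_big /= sqnorm_gram /eval mulr_sumr.
apply: eq_bigr => i _.
have E (j : 'I_10) : \sum_(k < 10) (gram b)`_j * ((moment (nth ([::], [::]) (walls t) k))`_j)%:~R *
    ((r k)`_i * (monomials x)`_i)%:~R =
    (gram b)`_j * ((monomials x)`_i)%:~R * (if i == j :> nat then 4 else 0).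
  transitivity (\sum_(k < 10) (gram b)`_j * ((monomials x)`_i)%:~R *
      ((r k)`_i * (nth [::] (map moment (walls t)) k)`_j)%:~R).
    apply: eq_bigr => k _; rewrite (nth_map ([::], [::])) ?sz // !intrM; ring.
  rewrite -mulr_sumr -(rmorph_sum intr) dual_wallsP //.
  by case: ifP.
under eq_bigr => j _ do rewrite E.
rewrite (bigD1 i) //= eqxx big1 => [|j ji]; first by rewrite addr0; ring.
by rewrite -val_eqE eq_sym in ji; rewrite (negPf ji) mulr0.
Qed.

Definition coef t b k : R := value b (nth ([::], [::]) (walls t) k).

Lemma sqnorm_edge_forms b x : 4 * sqnorm b x =
  \sum_(k < 10) coef 1 b k * ((pairing (nth 0 edge_forms k) x)%:~R) ^+ 2.
Proof.
rewrite (ray_expansion b x dual_walls_K5); apply: eq_bigr => k _; congr (_ * _).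
rewrite /rays cats0 (nth_map 0) ?square_coefsE ?rmorphXn //.
Qed.

Lemma sqnorm_frame t b x j : (t == 2) || (t == 3) -> (j < 3)%N -> 4 * sqnorm b x =
  \sum_(k < 9) coef t b k * ((pairing (nth 0 (forms t) k) x)%:~R) ^+ 2 +
  coef t b 9 * \sum_(l <- frame j) ((pairing l x)%:~R) ^+ 2.
Proof.
move=> t23 j3; have dt : dual_walls t.
  by case/orP: t23 => /eqP->; [exact: dual_walls_K33 | exact: dual_walls_K5e].
have sz : size (forms t) = 9%N by case/orP: t23 => /eqP->.
have t1 : (t == 1%N) = false by case/orP: t23 => /eqP->.
rewrite (ray_expansion b x dt) big_ord_recr /=; congr (_ + _ * _).
  apply: eq_bigr => k _; congr (_ * _).
  by rewrite /rays nth_cat size_map sz ltn_ord (nth_map 0) ?sz // square_coefsE rmorphXn.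
rewrite /rays nth_cat size_map sz ltnn subnn t1 /= (frame_coefsE _ j3) rmorph_sum.
by apply: eq_bigr => l _; rewrite rmorphXn.
Qed.

Lemma value_rebase b g A :
  value (rebase b g) A = value b (map (comb g) A.1, map (comb g) A.2).
Proof.
by rewrite /value !big_map; congr (_ - _); apply: eq_bigr => v _; rewrite sqnorm_rebase.
Qed.

Lemma value_eq b A A' : moment A = moment A' -> value b A = value b A'.
Proof. by move=> E; rewrite !value_moment E. Qed.

Lemma value_swap b A : value b (A.2, A.1) = - value b A.
Proof. by rewrite /value opprB. Qed.

Lemma coef_neighbour t b k : (k < size (neighbours t))%N ->
  coef t b k = weight (neighbour t k).1 (rebase b (neighbour t k).2) - weight t b.
Proof.
move=> kt; rewrite /coef /walls nth_cat size_map kt (nth_map (0%N, unit_quad)) //.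
by rewrite /value /= weight_rebase.
Qed.

Lemma neighbourP t k : t \in iota 1 3 -> (k < size (neighbours t))%N ->
  (neighbour t k).1 \in iota 1 3 /\ unimodular (neighbour t k).2.
Proof.
move=> tC kt; have /allP H := allP neighbours_unimodular t tC.
by have /andP[h1 /unimodularbP h2] := H _ (mem_nth (0%N, unit_quad) kt); split.
Qed.

Lemma coef_ge0 t b k : t \in iota 1 3 -> minimal t b -> (k < size (neighbours t))%N ->
  0 <= coef t b k.
Proof.
move=> tC mtb kt; rewrite coef_neighbour // subr_ge0.
by have [h1 h2] := neighbourP tC kt; apply: mtb.
Qed.

Lemma minimal_neighbour t b k : t \in iota 1 3 -> minimal t b ->
  (k < size (neighbours t))%N -> coef t b k = 0 ->
  minimal (neighbour t k).1 (rebase b (neighbour t k).2).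
Proof.
move=> tC mtb kt c0; have [_ ug] := neighbourP tC kt.
by apply: minimal_rebase mtb ug _; move: c0; rewrite coef_neighbour // => /subr0_eq.
Qed.

(** The hypothesis on moments holds when g permutes the pairs in S_t. *)
Lemma minimal_symmetry t b g : minimal t b -> unimodular g ->
  moment ([seq comb g v | v <- reps t], reps t) = moment ([::], [::]) ->
  minimal t (rebase b g).
Proof.
move=> mtb ug /(value_eq b) E; apply: minimal_rebase mtb ug _; apply/subr0_eq.
by rewrite weight_rebase; move: E; rewrite /value !big_nil subrr.
Qed.

Definition reversal : quad vec := ((0, 0, 0, 1), (0, 0, 1, 0), (0, 1, 0, 0), (1, 0, 0, 0))%Z.

(** The reversal of the coordinates preserves S_2 and exchanges the two cones that
    meet along the wall opposite to Q. *)
Lemma coef_reversal b : coef 2 (rebase b reversal) 9 = - coef 2 b 9.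
Proof.
by rewrite /coef value_rebase -value_swap; apply: value_eq; vm_compute.
Qed.

Lemma minimal_reversal b : minimal 2 b -> minimal 2 (rebase b reversal).
Proof.
move=> m2; apply: minimal_symmetry => //; first by apply: unimodularbP; vm_compute.
Qed.

Definition reduced b : Prop :=
  [\/ minimal 1 b,
      exists2 t, (t == 2) || (t == 3) & minimal t b /\ 0 < coef t b 9 |
      [/\ minimal 2 b, coef 2 b 9 = 0 & forall k, (k < 9)%N -> 0 < coef 2 b k]].

(** If a coefficient vanishes, the form lies on the wall, and the neighbouring cone is
    minimal too.  This leads from cone 3 without Q to cone 1, and from cone 2 with two
    vanishing coefficients, one of them that of Q, to cone 3. *)
Lemma exists_reduced b : bounded_balls (sqnorm b) ->
  exists2 g, unimodular g & reduced (rebase b g).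
Proof.
move=> bb; have [t [g [tC ug mt]]] := exists_minimal bb.
have red3 g' : unimodular g' -> minimal 3 (rebase b g') ->
    exists2 g, unimodular g & reduced (rebase b g).
  move=> ug' m3; have c9 := @coef_ge0 3 _ 9 isT m3 isT.
  have [c0|c0] := eqVneq (coef 3 (rebase b g') 9) 0; last first.
    by exists g' => //; apply: Or32; exists 3%N => //; split=> //; rewrite lt0r c0.
  have := @minimal_neighbour 3 _ 9 isT m3 isT c0; rewrite rebase_assoc => m1.
  have [_ u9] := @neighbourP 3 9 isT isT.
  by eexists; [exact: unimodular_rebase ug' u9 | apply: Or31].
have red2 g' : unimodular g' -> minimal 2 (rebase b g') -> 0 <= coef 2 (rebase b g') 9 ->
    exists2 g, unimodular g & reduced (rebase b g).
  move=> ug' m2 c9.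
  have [c0|c0] := eqVneq (coef 2 (rebase b g') 9) 0; last first.
    by exists g' => //; apply: Or32; exists 2%N => //; split=> //; rewrite lt0r c0.
  have [all_pos|] := pselect (forall k, (k < 9)%N -> 0 < coef 2 (rebase b g') k).
    by exists g' => //; apply: Or33.
  move=> /existsNP[k /not_implyP[k9 /negP]]; rewrite -leNgt => ck.
  have {}ck : coef 2 (rebase b g') k = 0 by apply/eqP; rewrite eq_le ck (@coef_ge0 2).
  have m3 := @minimal_neighbour 2 _ k isT m2 k9 ck.
  have [_ uk] := @neighbourP 2 k isT k9.
  have t3 : (neighbour 2 k).1 = 3%N.
    have /allP H : all (fun k => (neighbour 2 k).1 == 3%N) (iota 0 9) by vm_compute.
    by apply/eqP/H; rewrite mem_iota.
  by move: m3; rewrite t3 rebase_assoc; apply: red3; exact: unimodular_rebase.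
move: tC mt; rewrite !inE => /or3P[] /eqP-> mt.
- by exists g => //; apply: Or31.
- have [c9|/ltW c9] := leP 0 (coef 2 (rebase b g) 9); first exact: (red2 g).
  apply: (red2 (rebase g reversal)).
  + by apply: unimodular_rebase => //; apply: unimodularbP; vm_compute.
  + by rewrite -rebase_assoc; exact: minimal_reversal.
  + by rewrite -rebase_assoc coef_reversal oppr_ge0.
- exact: (red3 g).
Qed.
End Reduction.

(** * Voronoi vectors of the reduced forms *)

(** The unimodular map g carries S_i onto the vectors of the pairs listed in S. *)
Definition same_pairs (i : nat) (g : quad vec) (S : seq vec) : bool :=
  [&& unimodularb g, all (fun v => comb g v \in pm S) (reps i)
    & all (fun v => comb (inverse_quad g) v \in pm (reps i)) S].

Section Classification.
Variable R : realType.
Implicit Types (b : quad 'rV[R]_4) (t : nat) (g : quad vec).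

Definition voronoi_type (i : nat) b : Prop :=
  forall x, strict_min (sqnorm b) x <-> x \in pm (reps i).

Definition classified b : Prop :=
  exists i g, [/\ (1 <= i <= 16)%N, unimodular g & voronoi_type i (rebase b g)].

Lemma classified_rebase b g : unimodular g -> classified (rebase b g) -> classified b.
Proof.
move=> ug [i [h [i16 uh ht]]]; exists i, (rebase g h); split=> //.
  exact: unimodular_rebase.
by rewrite -rebase_assoc.
Qed.

Lemma strict_min_rebase b g x : unimodular g ->
  strict_min (sqnorm (rebase b g)) x <-> strict_min (sqnorm b) (comb g x).
Proof.
move=> ug; have gi := unimodular_inj ug; case: ug => h gh _.
have gsur y : y = comb g (comb h y) by rewrite -comb_rebase gh comb_unit.
split=> -[x0 H]; split=> [E|w wx wNx].
- by apply: x0; apply: gi; rewrite E raddf0.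
- rewrite -sqnorm_rebase [w]gsur -raddfMn -raddfD -sqnorm_rebase.
  apply: H => E; [apply: wx | apply: wNx]; rewrite {1}[w]gsur -raddfMn -raddfD E ?raddfN //.
- by apply: x0; rewrite E raddf0.
rewrite !sqnorm_rebase raddfD raddfMn; apply: H => E.
  by apply: wx; apply: gi; rewrite raddfD raddfMn.
by apply: wNx; apply: gi; rewrite raddfD raddfMn raddfN.
Qed.

Lemma classified_of_pairs b i g S : (1 <= i <= 16)%N ->
  (forall x, strict_min (sqnorm b) x <-> x \in pm S) -> same_pairs i g S -> classified b.
Proof.
move=> i16 HS /and3P[ug /allP iS /allP Si]; have /andP[/eqP gh /eqP hg] := ug.
exists i, g; split=> //; first exact: unimodularbP.
move=> x; rewrite strict_min_rebase; last exact: unimodularbP.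
rewrite HS; split; rewrite !mem_pm.
  have E y : y = comb (inverse_quad g) (comb g y) by rewrite -comb_rebase hg comb_unit.
  case/orP=> [/Si|]; first by rewrite -E mem_pm.
  by rewrite -raddfN => /Si; rewrite -E mem_pm opprK orbC.
case/orP=> /iS; rewrite mem_pm //.
by rewrite raddfN opprK orbC.
Qed.

Lemma sqnormN b x : sqnorm b (- x) = sqnorm b x.
Proof. by rewrite /sqnorm raddfN dotNl dotNr opprK. Qed.

Lemma sqnorm0 b x : sqnorm b 0 <= sqnorm b x.
Proof. by rewrite {1}/sqnorm raddf0 dot0r; exact: dot_ge0. Qed.

Lemma sqnorm_strict_min_list b (V S : seq vec) :
  all_classes V -> {subset S <= V} ->
  (forall v, v \in S -> strict_min (sqnorm b) v) ->
  (forall v y, v \in V -> v \notin S -> parity v = parity y -> ~ strict_min (sqnorm b) y) ->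
  forall x, strict_min (sqnorm b) x <-> x \in pm S.
Proof. exact: (strict_min_list (sqnormN b) (sqnorm0 b)). Qed.

(** The factor 4 is the one of [dual_walls]. *)
Lemma governed_of_coefs (c : nat -> R) (l : nat -> vec) (n : nat) (N : seq vec) (f : vec -> R) :
  (forall x, 4 * f x = \sum_(k < n) c k * ((pairing (l k) x)%:~R) ^+ 2) ->
  (forall k, (k < n)%N -> 0 <= c k) ->
  (forall k, (k < n)%N -> c k != 0 -> l k \in N) ->
  (forall v, v \in N -> exists2 k, (k < n)%N & v = l k /\ 0 < c k) ->
  governed N f.
Proof.
move=> fE c0 cN Nc.
apply: (@governed_square_sum R [seq (c k / 4, l k) | k <- iota 0 n]).
- move=> x; rewrite /square_sum big_map -[in iota 0 n](subn0 n) -/(index_iota 0 n) big_mkord.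
  rewrite -[f x](mulKf (_ : 4 != 0)) ?pnatr_eq0 // fE mulr_sumr.
  by apply: eq_bigr => k _ /=; rewrite mulrA [c k / 4]mulrC.
- by move=> _ /mapP[k + ->]; rewrite mem_iota => /= kn; rewrite divr_ge0 ?c0.
- move=> _ /mapP[k + ->]; rewrite mem_iota => /= kn; rewrite mulf_eq0 negb_or => /andP[ck _].
  exact: cN.
move=> v /Nc[k kn [-> ck]]; exists (c k / 4); first by rewrite divr_gt0.
by apply/mapP; exists k; rewrite // mem_iota.
Qed.

Lemma reps_all_classes : all (fun t => all_classes (reps t)) (iota 1 3).
Proof. by vm_compute. Qed.

Lemma reps_nonzero : all (fun t => (0 : vec) \notin reps t) (iota 1 16).
Proof. by vm_compute. Qed.

Lemma reps_neq0 t v : t \in iota 1 16 -> v \in reps t -> v <> 0.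
Proof. by move=> /(allP reps_nonzero) r0 vt v0; rewrite v0 (negPf r0) in vt. Qed.

Lemma strict_K33 : all (strictb (forms 2)) (reps 2). Proof. by vm_compute. Qed.

Lemma classified_K33 b : coef 2 b 9 = 0 -> (forall k, (k < 9)%N -> 0 < coef 2 b k) -> classified b.
Proof.
move=> c9 cpos; apply: (@classified_of_pairs b 2 unit_quad (reps 2)); [by [] | | by vm_compute].
have gov : governed (forms 2) (sqnorm b).
  apply: (@governed_of_coefs (coef 2 b) (nth 0 (forms 2)) 9).
  - by move=> x; rewrite (@sqnorm_frame _ 2 b x 0) // c9 mul0r addr0.
  - by move=> k /cpos/ltW.
  - by move=> k k9 _; apply: mem_nth.
  move=> v vN; have vi : (index v (forms 2) < 9)%N by rewrite -[9%N]/(size (forms 2)) index_mem.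
  by exists (index v (forms 2)); rewrite // nth_index //; split=> //; exact: cpos.
apply: (@sqnorm_strict_min_list b (reps 2)).
- exact: (allP reps_all_classes 2%N).
- by [].
- by move=> v vr; apply: governed_strict gov (reps_neq0 _ vr) (allP strict_K33 v vr).
by move=> v y ->.
Qed.

Definition frame_union (s : seq nat) : seq vec := flatten [seq frame j | j <- s].

Definition others (j : nat) : seq nat := [seq k <- iota 0 3 | k != j].

(** The vector of S_t on which the form omitted from frame j takes the value 2, up to
    sign, and the other forms of the frame vanish.  These three pairs and the roots
    S_9 make up S_t. *)
Definition long (t j : nat) : vec :=
  vec_rep (nth 0 [:: if t == 2 then 2 else 4; 15; 16] j)%N.

(** The forms that decide about [long t j].  Frame j is left out, as its omitted form
    takes the value 2 there; the other two frames make up Q on their own.  The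
    bits m tell which of the three coefficients of the frame are nonzero: if one
    vanishes, the vector with value 2 on that form and 0 on the rest of the frame is
    tied with [long t j]. *)
Definition long_forms (t j : nat) (m : bitseq) : seq vec :=
  [seq nth 0 (forms t) (3 * j + i)%N | i <- iota 0 3 & nth false m i] ++
  frame_union (others j).

Fixpoint all_bits (n : nat) : seq bitseq :=
  if n is n'.+1 then [seq x :: m | x <- [:: false; true], m <- all_bits n'] else [:: [::]].

Lemma mem_all_bits m : m \in all_bits (size m).
Proof.
elim: m => //= x m IH; rewrite cats0 mem_cat.
by case: x; rewrite !map_f ?orbT.
Qed.

Lemma strict_roots : all (strictb (frame_union (iota 0 3))) (reps 9).
Proof. by vm_compute. Qed.

Lemma long_status_table : all (fun t => all (fun j => all (fun m =>
    if all id m then strictb (long_forms t j m) (long t j)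
    else tiedb (long_forms t j m) (long t j)) (all_bits 3)) (iota 0 3)) [:: 2; 3].
Proof. by vm_compute. Qed.

Definition D4_pairs (t : nat) (m : bitseq) : seq vec :=
  reps 9 ++ [seq long t j | j <- iota 0 3 & nth false m j].

(** The index i and a unimodular map from S_i to [D4_pairs t m]. *)
Definition D4_type (t : nat) (m : bitseq) : nat * quad vec :=
  match m with
  | [:: false; false; false] => (9%N, ((0, 0, 0, 1), (0, -1, 0, 0), (0, 1, 1, 0), (1, 0, 0, 0))%Z)
  | [:: false; false; true] => (7%N, ((0, 0, 1, 0), (0, -1, 0, -1), (0, 1, 0, 0), (-1, 0, -1, 0))%Z)
  | [:: false; true; false] => (7%N, ((0, 0, 0, 1), (0, -1, -1, 0), (0, 1, 0, 0), (-1, 0, 0, -1))%Z)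
  | [:: false; true; true] => (5%N, ((0, 0, 0, 1), (0, -1, -1, 0), (-1, 0, 0, -1), (0, 1, 0, 0))%Z)
  | [:: true; false; false] => (7%N, if t == 2
      then ((0, 1, 0, 0), (-1, 1, 0, 0), (0, -1, 0, -1), (0, -1, -1, 0))%Z
      else ((0, 1, 0, 1), (-1, 1, 0, 0), (0, -1, 0, 0), (0, -1, -1, -1))%Z)
  | [:: true; false; true] => (5%N, if t == 2
      then ((0, 0, 1, 0), (0, -1, 0, -1), (0, 1, 0, 0), (-1, 0, -1, 0))%Z
      else ((0, 0, 1, 0), (0, 1, 1, 1), (0, -1, -1, 0), (1, 0, 0, 0))%Z)
  | [:: true; true; false] => (5%N, if t == 2
      then ((0, 0, 0, 1), (0, -1, -1, 0), (0, 1, 0, 0), (-1, 0, 0, -1))%Z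
      else ((0, 0, 0, 1), (0, 1, 1, 1), (0, -1, 0, -1), (1, 0, 0, 0))%Z)
  | _ => if t == 2 then (2%N, unit_quad)
         else (3%N, ((0, 1, 0, 0), (1, 0, 0, 0), (0, 0, 0, 1), (0, 0, 1, 0))%Z)
  end.

Lemma D4_type_correct : all (fun t => all (fun m =>
  let: (i, g) := D4_type t m in (i \in iota 1 16) && same_pairs i g (D4_pairs t m)) (all_bits 3)) [:: 2; 3].
Proof. by vm_compute. Qed.

Lemma D4_reps : all (fun t => all (fun v => (v \in reps 9) || (v \in [seq long t j | j <- iota 0 3]))
  (reps t) && all (fun v => v \in reps t) (reps 9 ++ [seq long t j | j <- iota 0 3])) [:: 2; 3].
Proof. by vm_compute. Qed.

Lemma forms_in_frames : all (fun t => all (fun k =>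
    (nth 0 (forms t) k \in frame_union (iota 0 3)) &&
    all (fun j => (k %/ 3 == j)%N || (nth 0 (forms t) k \in frame_union (others j))) (iota 0 3))
  (iota 0 9)) [:: 2; 3].
Proof. by vm_compute. Qed.

(** Q is the average of the sums of squares over the frames in s. *)
Lemma sqnorm_frame_union t b x s : (t == 2) || (t == 3) -> all (fun j => j < 3)%N s ->
  (0 < size s)%N -> 4 * sqnorm b x = \sum_(k < 9 + size (frame_union s))
    (if (k < 9)%N then coef t b k else coef t b 9 / (size s)%:R) *
    ((pairing (nth 0 (forms t ++ frame_union s) k) x)%:~R) ^+ 2.
Proof.
move=> t23 /allP s3 s0; have sz : size (forms t) = 9%N by case/orP: t23 => /eqP->.
rewrite big_split_ord /=.
have -> : \sum_(i < size (frame_union s)) (if (9 + i < 9)%N then coef t b (9 + i)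
      else coef t b 9 / (size s)%:R) *
      ((pairing (nth 0 (forms t ++ frame_union s) (9 + i)) x)%:~R) ^+ 2 =
    (size s)%:R^-1 * \sum_(j <- s) coef t b 9 * \sum_(l <- frame j) ((pairing l x)%:~R) ^+ 2.
  under eq_bigr => i _ do rewrite ltnNge leq_addr /= nth_cat sz ltnNge leq_addr /= addKn.
  rewrite -!mulr_sumr mulrA [_^-1 * _]mulrC; congr (_ * _).
  rewrite -(big_mkord xpredT (fun i => ((pairing (nth 0 (frame_union s) i) x)%:~R : R) ^+ 2)).
  rewrite -(big_nth 0 xpredT (fun l => ((pairing l x)%:~R : R) ^+ 2)).
  by rewrite big_flatten big_map.
under eq_bigr => k _ do rewrite ltn_ord nth_cat sz ltn_ord.
set P := \sum_(i < 9) _.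
have E j : j \in s -> coef t b 9 * \sum_(l <- frame j) ((pairing l x)%:~R) ^+ 2 =
    4 * sqnorm b x - P.
  by move=> /s3 j3; rewrite (@sqnorm_frame _ t b x j) // addrC addKr.
rewrite big_seq (eq_bigr (fun=> 4 * sqnorm b x - P)) // -big_seq big_const_seq count_predT.
rewrite iter_addr_0 -[(_ - P) *+ _]mulr_natl mulrA mulVf ?mul1r ?pnatr_eq0 -?lt0n //.
by rewrite addrC subrK.
Qed.

Lemma governed_D4 t b s (N : seq vec) :
  (t == 2) || (t == 3) -> all (fun j => j < 3)%N s -> (0 < size s)%N ->
  (forall k, (k < 9)%N -> 0 <= coef t b k) -> 0 < coef t b 9 ->
  (forall k, (k < 9)%N -> coef t b k != 0 -> nth 0 (forms t) k \in N) ->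
  {subset frame_union s <= N} ->
  (forall v, v \in N -> v \notin frame_union s ->
     exists2 k, (k < 9)%N & v = nth 0 (forms t) k /\ coef t b k != 0) ->
  governed N (sqnorm b).
Proof.
move=> t23 s3 s0 c0 c9 cN fN Nc.
have sz : size (forms t) = 9%N by case/orP: t23 => /eqP->.
have s00 : 0 < (size s)%:R :> R by rewrite ltr0n.
apply: (@governed_of_coefs (fun k => if (k < 9)%N then coef t b k else coef t b 9 / (size s)%:R)
  (nth 0 (forms t ++ frame_union s)) (9 + size (frame_union s))).
- by move=> x; rewrite (@sqnorm_frame_union t b x s).
- by move=> k _; case: ifP => [/c0//|_]; rewrite divr_ge0 ?ltW.
- move=> k kn; rewrite nth_cat sz; case: ifP => [|k9 _]; first exact: cN.
  by apply: fN; apply: mem_nth; rewrite ltn_subLR // leqNgt k9.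
move=> v vN; have [vF|/(Nc v vN)[k k9 [-> ck]]] := boolP (v \in frame_union s).
  exists (9 + index v (frame_union s))%N; first by rewrite ltn_add2l index_mem.
  rewrite nth_cat sz ltnNge leq_addr /= addKn nth_index //; split=> //.
  by rewrite divr_gt0.
exists k; first by rewrite ltn_addr.
by rewrite nth_cat sz k9 lt0r ck c0.
Qed.

Lemma classified_D4 t b : (t == 2) || (t == 3) ->
  (forall k, (k < 9)%N -> 0 <= coef t b k) -> 0 < coef t b 9 -> classified b.
Proof.
move=> t23 c0 c9; have t23' : t \in [:: 2; 3]%N by rewrite !inE.
have tC : t \in iota 1 3 by case/orP: t23 => /eqP->.
pose nz j := [seq coef t b (3 * j + i) != 0 | i <- iota 0 3].
pose m := [seq all id (nz j) | j <- iota 0 3].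
have mE : m \in all_bits 3 by exact: (mem_all_bits m).
case Etype: (D4_type t m) => [i g].
have := allP (allP D4_type_correct t t23') m mE; rewrite Etype => /andP[i16 Hg].
apply: classified_of_pairs Hg; first by rewrite mem_iota in i16.
have gov_all : governed (frame_union (iota 0 3)) (sqnorm b).
  apply: (@governed_D4 t b (iota 0 3)) => // [k k9 _|v ->//].
  have := allP (allP forms_in_frames t t23') k; rewrite mem_iota => /(_ k9).
  by case/andP.
have gov_long j : (j < 3)%N -> governed (long_forms t j (nz j)) (sqnorm b).
  move=> j3; apply: (@governed_D4 t b (others j)) => //.
  - by apply/allP => k; rewrite mem_filter mem_iota => /and3P[].
  - by case: j j3 => [|[|[|]]].
  - move=> k k9 ck; rewrite /long_forms mem_cat.
    have := allP (allP forms_in_frames t t23') k; rewrite mem_iota => /(_ k9) /andP[_ /allP /(_ j)].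
    rewrite mem_iota => /(_ j3) /orP[/eqP kj|->]; last by rewrite orbT.
    apply/orP; left; apply/mapP; exists (k %% 3)%N.
      rewrite mem_filter mem_iota ltn_mod andbT (nth_map 0%N) ?size_iota ?ltn_mod //.
      by rewrite nth_iota ?ltn_mod // -kj mulnC -divn_eq.
    by rewrite -kj mulnC -divn_eq.
  - by move=> v vF; rewrite /long_forms mem_cat vF orbT.
  move=> v; rewrite /long_forms mem_cat => /orP[|->//] /mapP[i'].
  rewrite mem_filter mem_iota add0n => /andP[+ /andP[_ i3]].
  rewrite (nth_map 0%N) ?size_iota // nth_iota // add0n => ci -> _.
  exists (3 * j + i')%N => //; first by lia.
have long_status j : (j < 3)%N -> if all id (nz j)
    then strictb (long_forms t j (nz j)) (long t j)
    else tiedb (long_forms t j (nz j)) (long t j).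
  move=> j3; have := allP (allP long_status_table t t23') j; rewrite mem_iota => /(_ j3) /allP.
  by apply; exact: (mem_all_bits (nz j)).
have reps_t := allP D4_reps t t23'.
have mj j : (j < 3)%N -> nth false m j = all id (nz j).
  by move=> j3; rewrite /m (nth_map 0%N) ?size_iota // nth_iota.
apply: (@sqnorm_strict_min_list b (reps t)).
- exact: (allP reps_all_classes t).
- case/andP: reps_t => _ /allP sub v; rewrite mem_cat => vS; apply: sub; rewrite mem_cat.
  case/orP: vS => [->//|/mapP[j]]; rewrite mem_filter => /andP[_ j3] ->.
  by rewrite (map_f (long t) j3) orbT.
- move=> v; rewrite mem_cat => /orP[v9|/mapP[j]].
    exact: governed_strict gov_all (reps_neq0 _ v9) (allP strict_roots v v9).
  rewrite mem_filter mem_iota add0n => /andP[+ /andP[_ j3]]; rewrite mj // => nzj ->.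
  have := long_status j j3; rewrite nzj; apply: governed_strict (gov_long j j3) _.
  apply: (@reps_neq0 t); first by case/orP: t23 => /eqP->.
  case/andP: reps_t => _ /allP; apply; rewrite mem_cat; apply/orP; right.
  by apply: map_f; rewrite mem_iota.
move=> v y vt vS; case/andP: reps_t => /allP /(_ v vt) + _.
have v9 : v \notin reps 9 by move: vS; rewrite mem_cat negb_or => /andP[].
rewrite (negPf v9) orFb => /mapP[j]; rewrite mem_iota add0n => /andP[_ j3] vE.
have nzj : all id (nz j) = false.
  apply/negP => nzj; move/negP: vS; apply; rewrite mem_cat; apply/orP; right.
  by rewrite vE; apply: map_f; rewrite mem_filter mj // nzj mem_iota.
have := long_status j j3; rewrite nzj -vE => st vy.
exact: governed_tied (gov_long j j3) st vy.
Qed.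

(** The exchange of the vertices a and a + 1 of K5, for a = 0, ..., 3: its action on
    the list of edges, and the corresponding change of coordinates. *)
Definition edge_swaps : seq (seq nat * quad vec) :=
  [:: ([:: 0; 4; 5; 6; 1; 2; 3; 7; 8; 9]%N,
       ((-1, -1, -1, -1), (0, 1, 0, 0), (0, 0, 1, 0), (0, 0, 0, 1)));
      ([:: 1; 0; 2; 3; 4; 7; 8; 5; 6; 9]%N,
       ((0, 1, 0, 0), (1, 0, 0, 0), (0, 0, 1, 0), (0, 0, 0, 1)));
      ([:: 0; 2; 1; 3; 5; 4; 6; 7; 9; 8]%N,
       ((1, 0, 0, 0), (0, 0, 1, 0), (0, 1, 0, 0), (0, 0, 0, 1)));
      ([:: 0; 1; 3; 2; 4; 6; 5; 8; 7; 9]%N,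
       ((1, 0, 0, 0), (0, 1, 0, 0), (0, 0, 0, 1), (0, 0, 1, 0)))]%Z.

Lemma edge_swaps_correct : all (fun s : seq nat * quad vec =>
  [&& unimodularb s.2,
      moment ([seq comb s.2 v | v <- reps 1], reps 1) == moment ([::], [::]) &
      all (fun k => (nth 0 s.1 k < 10)%N &&
        (moment (let w := nth ([::], [::]) (walls 1) k in
                 ([seq comb s.2 v | v <- w.1], [seq comb s.2 v | v <- w.2])) ==
         moment (nth ([::], [::]) (walls 1) (nth 0 s.1 k)))) (iota 0 10)])%N edge_swaps.
Proof. by vm_compute. Qed.

Definition act (p : seq nat) (m : bitseq) : bitseq := [seq nth false m (nth 0%N p k) | k <- iota 0 10].

Fixpoint lex_lt (m m' : bitseq) : bool :=
  match m, m' with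
  | x :: r, y :: r' => (~~ x && y) || ((x == y) && lex_lt r r')
  | _, _ => false
  end.

(** Vertex exchanges that decrease a set of edges lexicographically lead to a local
    minimum; n bounds the number of exchanges. *)
Fixpoint descend (n : nat) (m : bitseq) : bitseq :=
  if n is n'.+1 then
    if [seq s <- edge_swaps | lex_lt (act s.1 m) m] is s :: _ then descend n' (act s.1 m)
    else m
  else m.

Definition support b : bitseq := [seq coef 1 b k != 0 | k <- iota 0 10].

Lemma nth_support b k : (k < 10)%N -> nth false (support b) k = (coef 1 b k != 0).
Proof. by move=> k10; rewrite (nth_map 0%N) ?size_iota // nth_iota. Qed.

Lemma minimal_swap b s : s \in edge_swaps -> minimal 1 b ->
  [/\ unimodular s.2, minimal 1 (rebase b s.2)
    & support (rebase b s.2) = act s.1 (support b)].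
Proof.
move=> /(allP edge_swaps_correct) /and3P[us /eqP sym /allP perm] m1.
have ug := unimodularbP us; split=> //; first exact: minimal_symmetry.
apply/eq_in_map => k kI; have /andP[pk /eqP momk] := perm k kI.
rewrite nth_support // /coef value_rebase; congr (_ != 0).
by rewrite -(value_eq b momk).
Qed.

Lemma minimal_descend n b : minimal 1 b -> exists g,
  [/\ unimodular g, minimal 1 (rebase b g) & support (rebase b g) = descend n (support b)].
Proof.
elim: n b => [|n IH] b m1.
  by exists unit_quad; rewrite rebase_unit; split=> //; exact: unimodular_unit.
rewrite -[descend _ _]/(if [seq s <- edge_swaps | lex_lt (act s.1 _) _] is s :: _
  then descend n (act s.1 _) else _).
case E: [seq s <- edge_swaps | lex_lt (act s.1 (support b)) (support b)] => [|s r].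
  by exists unit_quad; rewrite rebase_unit; split=> //; exact: unimodular_unit.
have sS : s \in edge_swaps.
  have : s \in s :: r by rewrite mem_head.
  by rewrite -E mem_filter => /andP[].
have [us ms <-] := minimal_swap sS m1; have [g [ug mg sg]] := IH _ ms.
exists (rebase s.2 g); rewrite -rebase_assoc; split=> //; exact: unimodular_rebase.
Qed.

Definition edges (m : bitseq) : seq vec :=
  [seq nth 0 edge_forms k | k <- iota 0 10 & nth false m k].

(** The connected graphs that no exchange of consecutive vertices decreases, as lists
    of edges; with each, the index i and a unimodular map from S_i to its
    Voronoi vectors. *)
Definition K5_table : seq (seq nat * (nat * quad vec)) :=
  [:: ([:: 3; 6; 8; 9]%N, (16%N, ((0, 0, 1, 0), (0, 1, 0, 0), (1, 0, 0, 0), (1, 1, 1, 1))));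
      ([:: 3; 6; 7; 9]%N, (16%N, ((0, 1, 0, 0), (0, 1, 1, 0), (1, 0, 0, 0), (1, 1, 1, 1))));
      ([:: 3; 6; 7; 8; 9]%N, (15%N, ((1, 0, 0, 0), (0, 0, 1, 0), (0, 1, 0, 0), (1, 1, 1, 1))));
      ([:: 3; 5; 7; 9]%N, (16%N, ((0, 1, 0, 0), (1, 0, 0, 0), (1, 1, 1, 0), (1, 1, 1, 1))));
      ([:: 3; 5; 7; 8]%N, (16%N, ((1, 0, 0, 0), (1, 0, 1, 0), (1, 1, 1, 0), (1, 1, 1, 1))));
      ([:: 3; 5; 7; 8; 9]%N, (15%N, ((1, 0, 0, 0), (0, 1, 0, 0), (1, 0, 1, 0), (1, 1, 1, 1))));
      ([:: 3; 5; 6; 7; 8]%N, (13%N, ((1, 1, 1, 1), (0, 0, 1, 0), (0, 1, 0, 0), (-1, -1, -1, 0))));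
      ([:: 3; 5; 6; 7; 8; 9]%N, (13%N, ((1, 1, 1, 1), (0, 0, 1, 0), (0, 1, 0, 0), (-1, -1, -1, 0))));
      ([:: 3; 4; 5; 7; 9]%N, (15%N, ((1, 1, 1, 0), (0, 1, 0, 0), (1, 0, 0, 0), (1, 1, 1, 1))));
      ([:: 3; 4; 5; 7; 8; 9]%N, (13%N, ((1, 1, 1, 1), (0, 0, 1, 0), (1, 0, 0, 0), (0, 1, 0, 0))));
      ([:: 3; 4; 5; 6; 7; 8; 9]%N, (12%N, ((1, 1, 1, 1), (0, 0, 1, 0), (0, 1, 0, 0), (1, 0, 0, 0))));
      ([:: 2; 3; 5; 6; 7; 8]%N, (10%N, ((0, 1, 0, 0), (1, 0, 0, 0), (1, 1, 1, 1), (-1, -1, 0, -1))));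
      ([:: 2; 3; 5; 6; 7; 8; 9]%N, (10%N, ((0, 1, 0, 0), (1, 0, 0, 0), (1, 1, 1, 1), (-1, -1, 0, -1))));
      ([:: 2; 3; 4; 8]%N, (16%N, ((0, 0, 1, 0), (1, 0, 0, 0), (1, 1, 0, 0), (1, 1, 0, 1))));
      ([:: 2; 3; 4; 8; 9]%N, (15%N, ((1, 0, 0, 0), (0, 0, 1, 0), (1, 1, 0, 1), (1, 1, 0, 0))));
      ([:: 2; 3; 4; 7; 8]%N, (13%N, ((1, 0, 0, 0), (0, 0, 0, 1), (1, 1, 0, 0), (0, 0, 1, 0))));
      ([:: 2; 3; 4; 7; 8; 9]%N, (13%N, ((1, 0, 0, 0), (0, 0, 0, 1), (1, 1, 0, 0), (0, 0, 1, 0))));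
      ([:: 2; 3; 4; 6; 8]%N, (15%N, ((0, 0, 1, 0), (0, 1, 0, 0), (1, 0, 0, 0), (1, 1, 0, 1))));
      ([:: 2; 3; 4; 6; 8; 9]%N, (14%N, ((0, 0, 1, 0), (0, 1, 0, 0), (1, 0, 0, 0), (-2, -2, -1, -1))));
      ([:: 2; 3; 4; 6; 7]%N, (11%N, ((0, 0, 0, 1), (0, 0, 1, 0), (0, 1, 0, 0), (1, 0, 0, 0))));
      ([:: 2; 3; 4; 6; 7; 9]%N, (11%N, ((0, 0, 0, 1), (0, 0, 1, 0), (0, 1, 0, 0), (1, 0, 0, 0))));
      ([:: 2; 3; 4; 6; 7; 8]%N, (11%N, ((0, 0, 0, 1), (0, 0, 1, 0), (0, 1, 0, 0), (1, 0, 0, 0))));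
      ([:: 2; 3; 4; 6; 7; 8; 9]%N, (11%N, ((0, 0, 0, 1), (0, 0, 1, 0), (0, 1, 0, 0), (1, 0, 0, 0))));
      ([:: 2; 3; 4; 5; 6; 7; 8]%N, (8%N, ((0, 1, 0, 0), (0, 0, 0, 1), (-1, -1, -1, -1), (0, 0, 1, 0))));
      ([:: 2; 3; 4; 5; 6; 7; 8; 9]%N, (8%N, ((0, 1, 0, 0), (0, 0, 0, 1), (-1, -1, -1, -1), (0, 0, 1, 0))));
      ([:: 1; 2; 3; 4; 5; 6]%N, (10%N, ((0, 0, 0, 1), (0, 0, 1, 0), (0, 1, 0, 0), (1, 0, 0, 0))));
      ([:: 1; 2; 3; 4; 5; 6; 9]%N, (8%N, ((0, 0, 0, 1), (1, 0, 0, 0), (0, 1, 0, 0), (-1, -1, -1, -1))));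
      ([:: 1; 2; 3; 4; 5; 6; 8; 9]%N, (6%N, ((0, 0, 1, 0), (1, 0, 0, 0), (0, 1, 0, 0), (-1, -1, -1, -1))));
      ([:: 1; 2; 3; 4; 5; 6; 7; 8; 9]%N, (4%N, ((1, 0, 0, 0), (0, 0, 0, 1), (-1, -1, -1, -1), (0, 0, 1, 0))));
      ([:: 0; 1; 2; 3; 4; 5; 6; 7; 8; 9]%N, (1%N, ((0, 0, 0, 1), (0, 0, 1, 0), (0, 1, 0, 0), (1, 0, 0, 0))))]%Z.

Definition edge_set (s : seq nat) : bitseq := [seq k \in s | k <- iota 0 10].

(** A disconnected graph has no edge across some cut; the cuts of K5 are the vectors
    of S_1, and a form with such a support vanishes there. *)
Lemma K5_cases : all (fun m => let m' := descend 10 m in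
  has (fun v => all (fun l => pairing l v == 0) (edges m')) (reps 1) ||
  has (fun e => edge_set e.1 == m') K5_table) (all_bits 10).
Proof. by vm_compute. Qed.

Lemma K5_table_correct : all (fun e : seq nat * (nat * quad vec) =>
  let N := edges (edge_set e.1) in
  [&& all (fun v => strictb N v || tiedb N v) (reps 1), e.2.1 \in iota 1 16 &
      same_pairs e.2.1 e.2.2 [seq v <- reps 1 | strictb N v]]) K5_table.
Proof. by vm_compute. Qed.

(** For a graph, the unique minima are its bonds: the cuts with two connected sides. *)
Lemma classified_K5 b : injective (comb b) -> minimal 1 b -> classified b.
Proof.
move=> bi m1; have [g [ug mg sg]] := minimal_descend 10 m1.
apply: (classified_rebase ug).
have {}bi : injective (comb (rebase b g)).
  by move=> x y; rewrite !comb_rebase => /bi /(unimodular_inj ug).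
move: (rebase b g) mg sg bi => b' {}m1 sE bi.
have fE := sqnorm_edge_forms b'.
have mS : support b \in all_bits 10.
  by rewrite -[10%N]/(size (support b)) mem_all_bits.
have := allP K5_cases _ mS; rewrite -sE => /orP[/hasP[v vr /allP v0]|/hasP[[e [i h]] eT /eqP /= eE]].
  suff v00 : v = 0 by have := @reps_neq0 1 v isT vr.
  apply: bi; rewrite raddf0; apply: dot_eq0; rewrite -/(sqnorm b' v).
  have : 4 * sqnorm b' v = 0.
    rewrite fE big1 // => k _; have [->|ck] := eqVneq (coef 1 b' k) 0; first by rewrite mul0r.
    have /eqP -> : pairing (nth 0 edge_forms k) v == 0.
      apply: v0; apply/mapP; exists (k : nat) => //.
      by rewrite mem_filter mem_iota nth_support // ck /=.
    by rewrite expr0n mulr0.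
  by move/eqP; rewrite mulf_eq0 pnatr_eq0 => /eqP.
have /and3P[/allP status i16 pairsP] := allP K5_table_correct _ eT.
rewrite mem_iota in i16; apply: classified_of_pairs pairsP => //.
have gov : governed (edges (edge_set e)) (sqnorm b').
  rewrite eE; apply: (@governed_of_coefs (coef 1 b') (nth 0 edge_forms) 10) => //.
  - by move=> k k10; exact: (@coef_ge0 R 1).
  - move=> k k10 ck; apply/mapP; exists k => //.
    by rewrite mem_filter mem_iota nth_support // ck.
  move=> v /mapP[k]; rewrite mem_filter mem_iota => /andP[+ /andP[_ k10]].
  rewrite nth_support // => ck ->; exists k => //; split=> //.
  by rewrite lt0r ck (@coef_ge0 R 1).
apply: (@sqnorm_strict_min_list b' (reps 1)).
- exact: (allP reps_all_classes 1%N).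
- by move=> v; rewrite mem_filter => /andP[].
- move=> v; rewrite mem_filter => /andP[sv vr].
  exact: governed_strict gov (reps_neq0 _ vr) sv.
move=> v y vr; rewrite mem_filter vr andbT => nsv vy.
have := status v vr; rewrite (negPf nsv) /= => tv.
exact: governed_tied gov tv vy.
Qed.

Lemma reduced_classified b : injective (comb b) -> reduced b -> classified b.
Proof.
move=> bi [m1|[t t23 [mt c9]]|[m2 c9 cpos]]; first exact: classified_K5.
  apply: (classified_D4 t23) => // k k9; case/orP: t23 mt => /eqP-> mt; last first.
    by apply: (@coef_ge0 R 3) => //; rewrite (ltn_trans k9).
  exact: (@coef_ge0 R 2).
exact: classified_K33.
Qed.

Lemma lattice_classified (L : set 'rV[R]_4) : is_lattice L ->
  exists b i, [/\ (1 <= i <= 16)%N, lattice_basis L b &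
    forall x, Vor L (comb b x) <-> x \in pm (reps i)].
Proof.
move=> /lattice_has_basis[b Lb bb].
have [g ug rg] := exists_reduced bb.
have bgi : injective (comb (rebase b g)).
  by move=> x y; rewrite !comb_rebase => /Lb.2 /(unimodular_inj ug).
have [i [h [i16 uh ht]]] := reduced_classified bgi rg.
have ugh := unimodular_rebase ug uh.
have [gh' ghE hgE] := ugh.
have Lbgh := lattice_basis_rebase ghE Lb (unimodular_inj ugh).
exists (rebase b (rebase g h)), i; split=> // x.
rewrite -ht rebase_assoc; apply: Vor_strict_min Lbgh _.
exact: bounded_balls_rebase hgE bb.
Qed.

End Classification.

(** * The sixteen graphs *)

Local Open Scope classical_set_scope.

Definition row_of (x : vec) : 'rV[int]_4 := let: (x1, x2, x3, x4) := x in vec4 x1 x2 x3 x4.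

Definition vec_of (r : 'rV[int]_4) : vec :=
  (r 0 (inord 0), r 0 (inord 1), r 0 (inord 2), r 0 (inord 3)).

Lemma vec_ofK : cancel vec_of row_of.
Proof.
move=> r; apply/rowP => -[[|[|[|[|//]]]] lt4]; rewrite !mxE /=;
  by congr (r _ _); apply: val_inj; rewrite /= inordK.
Qed.

Lemma row_ofK : cancel row_of vec_of.
Proof.
move=> [[[x1 x2] x3] x4]; rewrite /vec_of /row_of /vec4 !mxE !inordK //.
Qed.

Lemma row_of_inj : injective row_of.
Proof. exact: can_inj row_ofK. Qed.

Lemma row_ofB x y : row_of (x - y) = row_of x - row_of y.
Proof.
move: x y => [[[x1 x2] x3] x4] [[[y1 y2] y3] y4]; apply/rowP => -[[|[|[|[|//]]]] lt4];
  by rewrite !mxE.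
Qed.

Lemma row_ofN x : row_of (- x) = - row_of x.
Proof.
move: x => [[[x1 x2] x3] x4]; apply/rowP => -[[|[|[|[|//]]]] lt4];
  by rewrite !mxE.
Qed.

Lemma vrepE j : vrep j = row_of (vec_rep j).
Proof.
do 18?[case: j => [|j]]; rewrite /vrep /vec_rep /row_of //.
all: by apply/rowP => -[[|[|[|[|//]]]] lt4]; rewrite !mxE.
Qed.

Lemma S_setE i x : S_set i (row_of x) <-> x \in pm (reps i).
Proof.
rewrite mem_pm; split=> [[j /= ji [E|E]]|].
- by move: E; rewrite vrepE => /row_of_inj ->; rewrite map_f.
- by move: E; rewrite vrepE -row_ofN => /row_of_inj ->; rewrite opprK map_f ?orbT.
case/orP=> /mapP[j ji E]; exists j => //; [left | right]; rewrite vrepE -E //.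
by rewrite row_ofN opprK.
Qed.

Lemma card_S_set i : (1 <= i <= 16)%N -> (S_set i #= `I_(S_card i))%card.
Proof.
move=> i16; have iI : i \in iota 1 16 by rewrite mem_iota.
have /allP H : all (fun i => uniq (pm (reps i)) && (size (pm (reps i)) == S_card i)) (iota 1 16).
  by vm_compute.
have /andP[Hu /eqP sz] := H i iI.
have -> : S_set i = (fun k => row_of (nth 0 (pm (reps i)) k)) @` `I_(S_card i).
  apply/seteqP; split=> [r|_ [k /= kn <-]]; last by apply/S_setE; rewrite mem_nth ?sz.
  rewrite -[r]vec_ofK => /S_setE rS; exists (index (vec_of r) (pm (reps i))).
    by rewrite /= -sz index_mem.
  by rewrite nth_index.
apply: inj_card_eq => k l /set_mem /= kn /set_mem /= ln /row_of_inj /eqP.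
by rewrite nth_uniq ?sz // => /eqP.
Qed.

Definition vertex_of (i : nat) (x : vec) : G_graph i := exist _ (row_of x) (mem_set Logic.I).

Lemma zero_notin_pm i : (1 <= i <= 16)%N -> (0 : vec) \notin pm (reps i).
Proof.
move=> i16; rewrite mem_pm oppr0 orbb; apply: (allP reps_nonzero).
by rewrite mem_iota.
Qed.

Lemma adj_vertex_of i x y : (1 <= i <= 16)%N ->
  adj (vertex_of i x) (vertex_of i y) <-> x - y \in pm (reps i).
Proof.
move=> i16; rewrite -S_setE row_ofB; split=> [[]//|Sxy]; split=> //.
move=> /(congr1 val) /= /row_of_inj xy; have := zero_notin_pm i16.
by rewrite -(subrr y) -{1}xy; move/negP; apply; apply/S_setE; rewrite row_ofB.
Qed.

Lemma vertex_of_vec i (p : G_graph i) : p = vertex_of i (vec_of (val p)).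
Proof. by apply: val_inj; exact/esym/vec_ofK. Qed.

(** * Colorings *)

Lemma modz_nat_ge0 (k : nat) (p : int) : (0 < k)%N -> 0 <= (p %% k)%Z.
Proof. by move=> k0; apply: modz_ge0; rewrite eqz_nat -lt0n. Qed.

Lemma modz_nat_lt (k : nat) (p : int) : (0 < k)%N -> (`|(p %% k)%Z| < k)%N.
Proof. by move=> k0; rewrite -ltz_nat gez0_abs ?modz_nat_ge0 // ltz_pmod. Qed.

Lemma dvdz_sub_mod (k : nat) (p q : int) : (0 < k)%N ->
  `|(p %% k)%Z|%N = `|(q %% k)%Z|%N -> (k %| p - q)%Z.
Proof.
move=> k0 E; rewrite -eqz_mod_dvd; apply/eqP.
by rewrite -[LHS]gez0_abs ?modz_nat_ge0 // E gez0_abs ?modz_nat_ge0.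
Qed.

Lemma colorable_mod i (m n : nat) (u w : vec) : (1 <= i <= 16)%N -> (0 < m)%N -> (0 < n)%N ->
  all (fun v => ~~ ((m %| pairing u v)%Z && (n %| pairing w v)%Z)) (reps i) ->
  colorable (G_graph i) (m * n).
Proof.
move=> i16 m0 n0 /allP H.
pose c x := (Ordinal (modz_nat_lt (pairing u x) m0), Ordinal (modz_nat_lt (pairing w x) n0)).
have cardE : #|{: 'I_m * 'I_n}| = (m * n)%N by rewrite card_prod !card_ord.
exists (fun p => cast_ord cardE (enum_rank (c (vec_of (val p))))) => p q.
rewrite {1}(vertex_of_vec p) {1}(vertex_of_vec q) adj_vertex_of //.
move: (vec_of (val p)) (vec_of (val q)) => x y xy /cast_ord_inj /enum_rank_inj [eu ew].
have := dvdz_sub_mod m0 eu; have := dvdz_sub_mod n0 ew; rewrite -!raddfB => dw du.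
move: xy; rewrite mem_pm => /orP[] /H; first by rewrite du dw.
by rewrite ![pairing _ (- _)]raddfN !rpredN du dw.
Qed.

(** Moduli m, n and linear forms u, w, as in [colorable_mod]. *)
Definition coloring_data (i : nat) : nat * nat * vec * vec :=
  match i with
  | 2 => (7, 1, (1, 2, 1, 2)%Z, (0, 0, 0, 0)%Z)
  | 3 => (6, 1, (1, 2, 1, 1)%Z, (0, 0, 0, 0)%Z)
  | 5 => (6, 1, (1, 3, 4, 2)%Z, (0, 0, 0, 0)%Z)
  | 7 => (6, 1, (1, 3, 2, 4)%Z, (0, 0, 0, 0)%Z)
  | 9 => (2, 2, (1, 1, 0, 0)%Z, (1, 0, 1, 1)%Z)
  | 10 => (4, 1, (2, 2, 2, 1)%Z, (0, 0, 0, 0)%Z)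
  | 14 => (3, 1, (1, 1, 1, 2)%Z, (0, 0, 0, 0)%Z)
  | _ => (G_chi i, 1, (1, 1, 1, 1)%Z, (0, 0, 0, 0)%Z)
  end%N.

Section Search.
Variables (adjacent : vec -> vec -> bool) (k : nat).

(** All ways to add v to one of the classes that contain no neighbour of v. *)
Fixpoint place (v : vec) (cls : seq (seq vec)) : seq (seq (seq vec)) :=
  if cls is c :: r then
    (if has (adjacent v) c then [::] else [:: (v :: c) :: r]) ++ [seq c :: r' | r' <- place v r]
  else [::].

Fixpoint partitionable (vs : seq vec) (cls : seq (seq vec)) : bool :=
  if vs is v :: vs' then
    has (partitionable vs')
      (place v cls ++ (if size cls < k then [:: [:: v] :: cls] else [::]))%N
  else true.

(** A coloring with k colors passes the search: when v is reached, the current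
    classes are those of distinct colors, and v either joins the class of its color
    or opens a new one, which is possible as there are only k colors. *)
Lemma partitionableP (color : vec -> 'I_k) vs :
  (forall x y, adjacent x y -> color x <> color y) -> partitionable vs [::].
Proof.
move=> Hc.
pose ok (c : seq vec) (a : 'I_k) := all (fun u => color u == a) c.
suff H cls cs : all2 ok cls cs -> uniq cs -> partitionable vs cls by exact: (H [::] [::]).
elim: vs cls cs => // v vs IH cls cs cls_cs Ucs /=.
rewrite has_cat; have [vcs|vcs] := boolP (color v \in cs).
  apply/orP; left; suff [r [rP r_ok]] : exists r, r \in place v cls /\ all2 ok r cs.
    by apply/hasP; exists r => //; apply: IH r_ok Ucs.
  elim: cls cs cls_cs vcs {Ucs IH} => [|c r IH] [|a cs] //= /andP[ca rcs].
  rewrite inE => /predU1P[va|/(IH _ rcs)[r' [r'P r'_ok]]].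
    exists ((v :: c) :: r); split=> /=; last by rewrite va eqxx ca.
    rewrite mem_cat; case: ifP => [/hasP[u uc /Hc]|_]; last by rewrite mem_head.
    by move/allP: ca => /(_ u uc) /eqP ->.
  exists (c :: r'); split=> /=; last by rewrite ca.
  by rewrite mem_cat map_f ?orbT.
apply/orP; right; have size_cs : size cls = size cs.
  elim: cls cs cls_cs {Ucs vcs} => [|c r IHr] [|a cs] //= /andP[_ /IHr ->] //.
have lt_k : (size cls < k)%N.
  rewrite size_cs; have /card_uniqP /= <- : uniq (color v :: cs) by rewrite /= vcs.
  by have := max_card (mem (color v :: cs)); rewrite card_ord.
rewrite lt_k /= orbF; apply: (IH _ (color v :: cs)) => /=; last by rewrite vcs.
by rewrite eqxx.
Qed.
End Search.

(** Vertices of a subgraph of G_i that needs the full number of colors; a clique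
    unless i is 2, 3, 5 or 7. *)
Definition obstruction (i : nat) : seq vec :=
  match i with
  | 2 => [:: (0, 0, 0, 0); (0, 0, 1, 0); (0, -1, 0, -1); (-1, 0, 0, -1); (0, 0, 1, -1);
             (-1, -1, 0, -1); (-1, 0, 0, 0); (0, 1, 1, 0); (0, 0, 0, -1); (-1, -1, -1, -1);
             (0, -1, 0, 0); (1, 0, 1, 0)]%Z
  | 3 => [:: (0, 0, 0, 0); (-1, 0, 0, 0); (0, 0, 1, 0); (0, 0, 1, 1); (0, 1, 1, 1);
             (0, 1, 1, 0); (1, 1, 1, 1); (1, 0, 1, 1)]%Z
  | 5 => [:: (0, 0, 0, 0); (0, -1, -1, 0); (-1, 0, -1, 0); (-1, -1, -1, 0); (-1, -1, -1, -1);
             (-1, 0, 0, 0); (-1, 0, 0, -1); (0, -1, 0, -1); (0, -1, 0, 0)]%Z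
  | 7 => [:: (0, 0, 0, 0); (0, 0, 1, 0); (0, 0, 0, 1); (1, 0, 1, 1); (0, -1, 0, 0);
             (0, -1, 0, -1); (1, 0, 1, 0); (1, 0, 0, 1); (1, -1, 0, 0); (0, -1, -1, 0)]%Z
  | 9 => [:: (0, 0, 0, 0); (1, 1, 1, 1); (1, 0, 1, 1); (1, 0, 1, 0)]%Z
  | 10 => [:: (0, 0, 0, 0); (1, 1, 1, 1); (1, 1, 0, 1); (1, 0, 0, 0)]%Z
  | 11 => [:: (0, 0, 0, 0); (1, 1, 1, 1); (1, 0, 1, 1); (1, 0, 0, 1); (1, 0, 0, 0)]%Z
  | 12 | 13 => [:: (0, 0, 0, 0); (0, 1, 1, 1); (0, 1, 1, 0); (0, 1, 0, 0)]%Z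
  | 14 => [:: (0, 0, 0, 0); (1, 1, 1, 1); (1, 0, 0, 0)]%Z
  | 15 => [:: (0, 0, 0, 0); (0, 1, 1, 0); (0, 1, 0, 0)]%Z
  | 16 => [:: (0, 0, 0, 0); (1, 0, 0, 0)]%Z
  | _ => [:: (0, 0, 0, 0); (1, 1, 1, 1); (1, 1, 1, 0); (1, 1, 0, 0); (1, 0, 0, 0)]%Z
  end.

Lemma coloring_data_correct : all (fun i => let: (m, n, u, w) := coloring_data i in
  [&& 0 < m, 0 < n, m * n == G_chi i &
      all (fun v => ~~ ((m %| pairing u v)%Z && (n %| pairing w v)%Z)) (reps i)])%N (iota 1 16).
Proof. by vm_compute. Qed.

Lemma obstruction_correct : all (fun i =>
  ~~ partitionable (fun x y => x - y \in pm (reps i)) (G_chi i).-1 (obstruction i) [::])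
  (iota 1 16).
Proof. by vm_compute. Qed.

Lemma colorable_leq (G : sgraph) m n : (m <= n)%N -> colorable G m -> colorable G n.
Proof.
move=> mn [c Hc]; exists (fun x => widen_ord mn (c x)) => x y /Hc cxy.
by move/(congr1 val) => /= /val_inj.
Qed.

Lemma chromatic_number_G i : (1 <= i <= 16)%N -> has_chromatic_number (G_graph i) (G_chi i).
Proof.
move=> i16; have iI : i \in iota 1 16 by rewrite mem_iota.
split.
  have := allP coloring_data_correct i iI; case: (coloring_data i) => [[[m n] u] w].
  by case/and4P=> m0 n0 /eqP <-; exact: colorable_mod.
move=> m col; rewrite leqNgt; apply/negP => lt_m.
have [c Hc] : colorable (G_graph i) (G_chi i).-1.
  by apply: colorable_leq col; rewrite -ltnS (ltn_predK lt_m).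
have /negP := allP obstruction_correct i iI; apply.
apply: (@partitionableP _ _ (fun x => c (vertex_of i x))) => x y xy.
by apply: Hc; apply/adj_vertex_of.
Qed.

(** * Isomorphism invariants *)

Lemma graph_iso_sym (G H : sgraph) : graph_iso G H -> graph_iso H G.
Proof.
case=> f [g fK gK] Hf; exists g; first by exists f.
by move=> x y; rewrite Hf !gK.
Qed.

Lemma graph_iso_colorable (G H : sgraph) m : graph_iso G H -> colorable H m -> colorable G m.
Proof. by case=> f _ Hf [c Hc]; exists (c \o f) => x y /Hf /Hc. Qed.

Lemma graph_iso_chromatic (G H : sgraph) k l : graph_iso G H ->
  has_chromatic_number G k -> has_chromatic_number H l -> k = l.
Proof.
move=> GH [Gk kmin] [Hl lmin]; apply/eqP; rewrite eqn_leq; apply/andP; split.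
  by apply: kmin; apply: graph_iso_colorable Hl.
by apply: lmin; apply: graph_iso_colorable Gk; apply: graph_iso_sym.
Qed.

Lemma card_neighbourhood i (p : G_graph i) : (1 <= i <= 16)%N ->
  ([set q | adj p q] #= `I_(S_card i))%card.
Proof.
move=> i16; apply: card_eq_trans (card_S_set i16).
have -> : S_set i = (fun q : G_graph i => val p - val q) @` [set q | adj p q].
  apply/seteqP; split=> [r|_ [q /= [_ Sq] <-] //].
  rewrite -[r]vec_ofK => rS; exists (vertex_of i (vec_of (val p) - vec_of r)).
    have := @adj_vertex_of i (vec_of (val p)) (vec_of (val p) - vec_of r) i16.
    rewrite -(vertex_of_vec p) subKr => pq; apply/pq; exact/S_setE.
  by rewrite -[LHS]/(val p - row_of (vec_of (val p) - vec_of r)) row_ofB !vec_ofK subKr.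
apply: card_esym; apply: inj_card_eq => q q' _ _ /addrI /oppr_inj; exact: val_inj.
Qed.

Lemma iso_card i j : (1 <= i <= 16)%N -> (1 <= j <= 16)%N ->
  graph_iso (G_graph i) (G_graph j) -> S_card i = S_card j.
Proof.
move=> i16 j16 [f fb Hf]; apply/card_eq_II.
pose p := vertex_of i 0.
have := card_neighbourhood (f p) j16.
have -> : [set q | adj (f p) q] = f @` [set q | adj p q].
  case: fb => g fK gK; apply/seteqP; split=> [q /= fq|_ [q /= pq <-]]; last exact/Hf.
  by exists (g q); rewrite ?gK //; apply/Hf; rewrite gK.
move=> H; apply: card_eq_trans (card_esym (card_neighbourhood p i16)) _.
apply: card_eq_trans _ H; apply: card_esym; apply: inj_card_eq => x y _ _.
exact: bij_inj.
Qed.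

Theorem theorem1p1 (R : realType) :
  (forall L : set 'rV[R]_4, is_lattice L ->
     exists2 i : nat, (1 <= i <= 16)%N & graph_iso (voronoi_graph L) (G_graph i))
  /\ (forall i j : nat, (1 <= i <= 16)%N -> (1 <= j <= 16)%N -> i <> j ->
        ~ graph_iso (G_graph i) (G_graph j))
  /\ (forall i : nat, (1 <= i <= 16)%N ->
        (S_set i #= `I_(S_card i))%card /\
        has_chromatic_number (G_graph i) (G_chi i)).
Proof.
split; [|split].
- move=> L /lattice_classified[b [i [i16 [Lb bi] HV]]]; exists i => //.
  have Lp (p : L) : exists x, val p = comb b x by apply/Lb; exact: set_mem (valP p).
  pose f (p : L) : G_graph i := vertex_of i (sval (cid (Lp p))).
  have fE p : val p = comb b (vec_of (val (f p))).
    by rewrite /f /= row_ofK; exact: svalP (cid (Lp p)).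
  pose g (q : G_graph i) : L :=
    exist _ (comb b (vec_of (val q))) (mem_set ((Lb _).2 (ex_intro _ _ erefl))).
  have fK : cancel f g by move=> p; apply: val_inj; rewrite /= -fE.
  have gK : cancel g f.
    move=> q; rewrite (vertex_of_vec (f (g q))) [in RHS](vertex_of_vec q); congr vertex_of.
    by apply: bi; rewrite -fE.
  exists f; first by exists g.
  move=> p q; have := @adj_vertex_of i (vec_of (val (f p))) (vec_of (val (f q))) i16.
  have -> : vec_of (val (f p)) - vec_of (val (f q)) \in pm (reps i) <-> Vor L (val p - val q).
    by rewrite -HV (fE p) (fE q) raddfB.
  rewrite -!vertex_of_vec => ->.
  split=> [[]//|V]; split=> // pq; move: V; rewrite pq subrr -(raddf0 (comb b)) HV.
  exact/negP/zero_notin_pm.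
- move=> i j i16 j16 ij ij_iso; apply: ij.
  have cij := iso_card i16 j16 ij_iso.
  have chi_ij := graph_iso_chromatic ij_iso (chromatic_number_G i16) (chromatic_number_G j16).
  have /allP H : all (fun i => all (fun j =>
      (S_card i == S_card j) && (G_chi i == G_chi j) ==> (i == j)) (iota 1 16)) (iota 1 16).
    by vm_compute.
  have := H i; rewrite mem_iota => /(_ i16) /allP /(_ j); rewrite mem_iota => /(_ j16).
  by rewrite cij chi_ij !eqxx => /eqP.
by move=> i i16; split; [exact: card_S_set | exact: chromatic_number_G].
Qed.
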